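(* Let $X$ be a one-dimensional Bessel process, $X_t=|W_t|$ with $W$ a one-dimensional Brownian motion, with state space $\mathbb X=[0,\infty)$; let $f(x)=x$ on $\mathbb X$ and $\delta(t)=\frac1{1+\beta t}$ with $\beta>0$. Let $a^*>0$ be characterized by $$a^*\int_0^\infty e^{-s}\sqrt{2\beta s}\,\tanh\!\big(a^*\sqrt{2\beta s}\big)\,ds=1 .$$ Then $R^*:=\bigcap_{R\in\mathcal E,\ R\text{ closed}}R$ equals $[a^*,\infty)$, and it is the unique closed optimal equilibrium.
   Context: $\mathcal B(\mathbb X)$ is the collection of Borel subsets of $\mathbb X$; $\mathbb P^x,\mathbb E^x$ denote probability and expectation given $X_0=x$, and $X^x$ denotes $X$ started at $x\in\mathbb X$. For $x\in\mathbb X$, $R\in\mathcal B(\mathbb X)$: $\rho(x,R):=\inf\{t>0: X^x_t\in R\}$ ($\inf\emptyset=\infty$) and $J(x,R):=\mathbb E^x[\delta(\rho(x,R))f(X_{\rho(x,R)})]$, where on $\{\rho(x,R)=\infty\}$ the integrand is taken to be $\limsup_{t\to\infty}\delta(t)f(X^x_t)$. Put $S_R:=\{x: f(x)>J(x,R)\}$, $I_R:=\{x: f(x)=J(x,R)\}$, and $\Theta(R):=S_R\cup(I_R\cap R)$. $R\in\mathcal B(\mathbb X)$ is an equilibrium if $\Theta(R)=R$; $\mathcal E$ is the set of all equilibria. $V(x,R):=\max\{f(x),J(x,R)\}$. $\hat R\in\mathcal E$ is an optimal equilibrium if $V(x,\hat R)\ge V(x,R)$ for all $x\in\mathbb X$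 and all $R\in\mathcal E$. ''Closed'' means closed relative to $\mathbb X$. *)

(* Defs.v *)
From HB Require Import structures.
From mathcomp Require Import all_boot all_order all_algebra.
From mathcomp Require Import all_classical all_reals all_analysis.
Import Order.TTheory GRing.Theory Num.Theory numFieldNormedType.Exports.

Set Implicit Arguments.
Unset Strict Implicit.
Unset Printing Implicit Defensive.

Local Open Scope classical_set_scope.
Local Open Scope ring_scope.

(* The second argument of [normal_prob] is the standard deviation.  For
   independence of the increments, the product rule is only stated for all the
   indices i < n at once: subfamilies are obtained with B i := setT. *)
Record brownian_motion (R : realType) (d : measure_display)
    (Omega : measurableType d) (P : probability Omega R)
    (W : R -> Omega -> R) : Prop := BrownianMotion {
  bm_measurable : forall t : R, 0 <= t -> measurable_fun [set: Omega] (W t) ;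
  bm_start : {ae P, forall w, W 0 w = 0} ;
  bm_continuous :
    {ae P, forall w, {within `[0, +oo[, continuous (fun t => W t w)}} ;
  bm_gaussian : forall (s t : R) (B : set R), 0 <= s -> s < t -> measurable B ->
    P [set w | B (W t w - W s w)] = normal_prob 0 (Num.sqrt (t - s)) B ;
  bm_independent : forall (n : nat) (t : nat -> R) (B : nat -> set R),
    0 <= t 0%N -> (forall i, t i <= t i.+1) -> (forall i, measurable (B i)) ->
    P [set w | forall i, (i < n)%N -> B i (W (t i.+1) w - W (t i) w)] =
    (\prod_(i < n) P [set w | B i (W (t i.+1) w - W (t i) w)%R])%E }.

(* Stopping problem with payoff f and discount function delta on a state space
   E contained in the real line; X x t is the process started at x, at time
   t. *)
Section stopping.
Context {R : realType} {d : measure_display} {Omega : measurableType d}.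
Variables (P : probability Omega R) (E : set R) (X : R -> R -> Omega -> R).
Variables (f delta : R -> R).

Definition hitting_time (x : R) (A : set R) (w : Omega) : \bar R :=
  ereal_inf [set t%:E | t in [set t : R | 0 < t /\ A (X x t w)]].

Definition stopped_payoff (x : R) (A : set R) (w : Omega) : \bar R :=
  match hitting_time x A w with
  | t%:E => (delta t * f (X x t w))%:E
  | _ => limf_esup (fun t => (delta t * f (X x t w))%:E) (+oo)%R
  end.

(* For a general Borel set A the payoff is only measurable for the completion of
   P.  The library integral of a nonnegative function is the supremum of the
   integrals of the simple measurable functions below it, so it then coincides
   with the integral for the completion. *)
Definition J (x : R) (A : set R) : \bar R := (\int[P]_w stopped_payoff x A w)%E.

Definition stopping_set (A : set R) : set R :=
  [set x | E x /\ (J x A < (f x)%:E)%E].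

Definition indifference_set (A : set R) : set R :=
  [set x | E x /\ (f x)%:E = J x A].

Definition Theta (A : set R) : set R :=
  stopping_set A `|` (indifference_set A `&` A).

Definition equilibrium (A : set R) : Prop :=
  [/\ A `<=` E, measurable A & Theta A = A].

Definition value (x : R) (A : set R) : \bar R := maxe (f x)%:E (J x A).

Definition optimal_equilibrium (A : set R) : Prop :=
  equilibrium A /\
  forall x B, E x -> equilibrium B -> (value x B <= value x A)%E.

Definition closed_in_state_space (A : set R) : Prop :=
  A `<=` E /\ closed (A : set (subspace E)).

End stopping.

Definition tanh (R : realType) (x : R) : R :=
  (expR x - expR (- x)) / (expR x + expR (- x)).

Definition threshold (R : realType) (beta a : R) : Prop :=
  0 < a /\
  (a%:E * \int[lebesgue_measure]_(s in `[0%R, +oo[)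
     (expR (- s) * Num.sqrt (2 * beta * s) *
        tanh (a * Num.sqrt (2 * beta * s)))%R%:E = 1)%E.

(* Main.v *)
From HB Require Import structures.
Require Import Defs.
From mathcomp Require Import all_boot all_order all_algebra.
From mathcomp Require Import all_classical all_reals all_analysis.
From mathcomp Require Import measurable_realfun ring lra.
Import Order.TTheory GRing.Theory Num.Theory numFieldNormedType.Exports.

(* Let Y = x + W start in a bounded gap (l, r) of the target, at offset y from
   the middle of the gap, and let sigma be the time at which Y leaves [l, r].
   Optional stopping of exp (theta W_t - theta^2 t / 2), carried out along
   dyadic grids, gives the Laplace transform of sigma, jointly with the exit
   point: E exp (- theta^2 sigma / 2) = cosh (theta y) / cosh (theta h) with
   h = (r - l) / 2.  Its continuity in h shows that Y crosses the ends of the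
   gap as soon as it reaches them, so that sigma is the hitting time of every
   target which has l and r in its closure.  As 1 / (1 + beta t) is the integral
   of exp (- s) exp (- beta s t) over s >= 0, expected payoffs follow by
   integrating over s with theta = sqrt (2 beta s).

   Waiting for the target pays less than x from x in a gap whose left end is
   nonnegative.  Hence an equilibrium B is dense in [r, +oo[, where r = inf B.
   From x < r it pays v(x, r), the mean of r cosh (theta x) / cosh (theta r),
   which is convex in x, with left derivative at x = r equal to
   G(r) = mean of r theta tanh (theta r).  So x <= v(x, r) for all x < r if and
   only if G(r) <= 1, i.e. r <= a, as G is increasing and G(a) = 1.  Finally
   cosh (theta x) / cosh (theta a) is a product of two decreasing functions of s,
   cosh (theta x) / cosh (theta r) and cosh (theta r) / cosh (theta a);
   Chebyshev's association inequality and r <= v(r, a) give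
   v(x, r) <= v(x, a), so no equilibrium does better than [a, +oo[. *)

Set Implicit Arguments.
Unset Strict Implicit.
Unset Printing Implicit Defensive.

Local Open Scope classical_set_scope.
Local Open Scope ring_scope.

(** * Independence of the increments from the past *)

(** The hypothesis [brownian_motion] grants no filtration and no stopping theorem, only the joint
    law of finitely many increments. Apart from a Gaussian estimate at integer times, all the
    probability comes from one discrete fact: a stopped exponential martingale of a Gaussian walk
    has constant mean. Stopped at a high level, it yields sublinear growth of the paths, so that
    never stopping pays 0; stopped outside an interval, it leads to the exit time.

    Two obstacles shape the rest. Continuity holds only almost surely, so the motion is exchanged
    for one with all paths well behaved. And the payoff for a Borel target need not be measurable:
    it is either bounded path by path or identified, outside a null set, with a function of an exit
    time.

    Reflection disappears once the target is symmetrised: a gap [0, r) becomes (-r, r) for x + W,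
    and a gap with nonnegative left end is left while x + W is still nonnegative. Convexity in x
    enters through explicit tangent bounds, which integrate over s directly and avoid a derivative
    under the integral sign. *)

Lemma ge0_integral_independent (R : realType) d (Omega : measurableType d)
    (P : probability Omega R) d1 (T1 : measurableType d1)
    d2 (T2 : measurableType d2) (X : {mfun Omega >-> T1})
    (Y : {mfun Omega >-> T2}) (nu : probability T2 R)
    (F : T1 -> \bar R) (g : T2 -> \bar R) :
  (forall A B, measurable A -> measurable B ->
     P (X @^-1` A `&` Y @^-1` B) = (P (X @^-1` A) * nu B)%E) ->
  measurable_fun setT F -> (forall x, 0 <= F x)%E ->
  measurable_fun setT g -> (forall x, 0 <= g x)%E ->
  (\int[P]_w (F (X w) * g (Y w)) = (\int[P]_w F (X w)) * \int[nu]_z g z)%E.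
Proof.
move=> indep mF F0 mg g0.
have mXY : measurable_fun setT (fun w => (X w, Y w)).
  by apply: measurable_fun_pair.
pose XY : {mfun Omega >-> (T1 * T2)%type} :=
  HB.pack (fun w => (X w, Y w)) (isMeasurableFun.Build _ _ _ _ _ mXY).
pose PX := distribution P X.
pose PXY := distribution P XY.
have prodE A : measurable A -> (PX \x nu)%E A = PXY A.
  by move=> mA; apply: product_measure_unique.
have mFg : measurable_fun setT (fun z : T1 * T2 => (F z.1 * g z.2)%E).
  apply: emeasurable_funM.
    exact: (measurableT_comp mF).
  exact: (measurableT_comp mg).
have -> : (\int[P]_w (F (X w) * g (Y w)) =
           \int[PXY]_z (F z.1 * g z.2))%E.
  rewrite /PXY /distribution ge0_integral_pushforward//.
  by move=> z _; rewrite mule_ge0.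
have -> : (\int[PXY]_z (F z.1 * g z.2) =
           \int[PX \x nu]_z (F z.1 * g z.2))%E.
  by apply: eq_measure_integral => A mA _; apply/esym; exact: prodE.
rewrite fubini_tonelli1//; last by move=> z; rewrite mule_ge0.
rewrite /fubini_F /=.
under eq_integral do rewrite ge0_integralZl//.
rewrite ge0_integralZr//; last exact: integral_ge0.
by rewrite /PX /distribution ge0_integral_pushforward.
Qed.

Section past.
Context {R : realType} {d : measure_display} {Omega : measurableType d}.
Variables (P : probability Omega R) (xi : nat -> Omega -> R).
Variable nu : probability (measurableTypeR R) R.
Hypothesis mxi : forall i, measurable_fun setT (xi i).
Hypothesis xi_law : forall i (B : set R), measurable B -> P (xi i @^-1` B) = nu B.
Hypothesis xi_indep : forall (n : nat) (B : nat -> set R),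
  (forall i, measurable (B i)) ->
  P [set w | forall i, (i < n)%N -> B i (xi i w)] =
  (\prod_(i < n) P (xi i @^-1` B i))%E.

(** These events form a pi-system, on which the product rule for increments can be read off. *)
Definition cylinder (n : nat) : set_system Omega :=
  [set A | exists B : nat -> set R, (forall i, measurable (B i)) /\
     A = [set w | forall i, (i < n)%N -> B i (xi i w)]].

(** The points of [Omega] under a coarser sigma-algebra: to be determined by the first [n]
    increments is then ordinary measurability. *)
Definition past (n : nat) : measurableType _ := g_sigma_algebraType (cylinder n).

Lemma measurable_preimage (f : Omega -> R) (B : set R) :
  measurable_fun setT f -> measurable B -> measurable (f @^-1` B).
Proof. by move=> mf mB; rewrite -[X in measurable X]setTI; exact: mf. Qed.

Lemma cylinder_measurable n : cylinder n `<=` @measurable _ Omega.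
Proof.
move=> A [B [mB ->]].
have -> : [set w | forall i, (i < n)%N -> B i (xi i w)] =
    \bigcap_(i in `I_n) (xi i @^-1` B i).
  by apply/seteqP; split => w.
by apply: fin_bigcap_measurable => // i _; exact: measurable_preimage.
Qed.

Lemma past_measurable n (A : set Omega) : (cylinder n).-sigma.-measurable A ->
  measurable A.
Proof.
apply: smallest_sub; last exact: cylinder_measurable.
exact: sigma_algebra_measurable.
Qed.

Lemma past_measurable_fun n d' (T : measurableType d') (f : Omega -> T) :
  measurable_fun (setT : set (past n)) f -> measurable_fun (setT : set Omega) f.
Proof. by move=> mf _ B mB; apply: past_measurable; apply: mf. Qed.

(** For fixed [B] both sides are finite measures in [A] that agree on the pi-system of cylinders,
    hence on the sigma-algebra it generates. *)
Lemma past_indep n (A : set Omega) (B : set R) :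
  (cylinder n).-sigma.-measurable A -> measurable B ->
  P (A `&` xi n @^-1` B) = (P A * nu B)%E.
Proof.
move=> mA mB.
have mD : measurable (xi n @^-1` B) by exact: measurable_preimage.
have nuB0 : 0 <= fine (nu B) by exact: fine_ge0.
have nuBE : (nu B = (fine (nu B))%:E)%E by rewrite fineK// fin_num_measure.
have := @g_sigma_algebra_measure_unique _ R Omega (cylinder n)
  (@cylinder_measurable n) (fun=> setT) _ _ (mrestr P mD)
  (mscale (NngNum nuB0) P).
rewrite /= => H.
have -> : P (A `&` xi n @^-1` B) = mrestr P mD A by [].
rewrite H//; [by rewrite /= /mscale/= -nuBE muleC| ..].
- move=> _; exists (fun=> setT); split => //.
  by apply/seteqP; split.
- by rewrite bigcup_const //; exists 0%N.
- move=> _ _ [B1 [mB1 ->]] [B2 [mB2 ->]].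
  exists (fun i => B1 i `&` B2 i); split; first by move=> i; apply: measurableI.
  apply/seteqP; split=> w /=.
    by move=> [h1 h2] i ni; split; [exact: h1|exact: h2].
  by move=> h; split => i /h [].
- move=> _ [C [mC ->]]; rewrite /= /mrestr /mscale/=.
  (* With [B] in position [n], the intersection is a cylinder of length [n.+1]. *)
  pose C' i := if i == n then B else C i.
  have mC' i : measurable (C' i) by rewrite /C'; case: ifP.
  have -> : [set w | forall i, (i < n)%N -> C i (xi i w)] `&` xi n @^-1` B =
      [set w | forall i, (i < n.+1)%N -> C' i (xi i w)].
    apply/seteqP; split=> w /=.
      move=> [h1 h2] i; rewrite ltnS leq_eqVlt /C' => /orP[/eqP ->|ni].
        by rewrite eqxx.
      by rewrite ltn_eqF//; exact: h1.
    move=> h; split=> [i ni|].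
      by have := h i (ltnW ni); rewrite /C' ltn_eqF.
    by have := h n (ltnSn n); rewrite /C' eqxx.
  rewrite xi_indep// big_ord_recr/= xi_indep// /C' eqxx xi_law// -nuBE muleC.
  by congr (_ * _)%E; apply: eq_bigr => i _; rewrite ltn_eqF.
- by move=> _; rewrite /= /mrestr setTI (le_lt_trans (probability_le1 _ _))// ltry.
Qed.

Lemma measurable_xi_past n i : (i < n)%N ->
  measurable_fun (setT : set (past n)) (xi i).
Proof.
move=> ni _ B mB; rewrite setTI; apply: sub_sigma_algebra.
exists (fun j => if j == i then B else setT); split.
  by move=> j; case: ifP.
apply/seteqP; split=> w /=.
  by move=> h j nj; case: eqP => [->|].
by move/(_ i ni); rewrite eqxx.
Qed.

(** The identity, seen as a random variable with values in [past n], carries the whole past at once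
    and serves as [X] in the product formula. *)
Lemma ge0_integral_past n (F : Omega -> \bar R) (g : R -> \bar R) :
  measurable_fun (setT : set (past n)) F -> (forall x, 0 <= F x)%E ->
  measurable_fun setT g -> (forall x, 0 <= g x)%E ->
  (\int[P]_w (F w * g (xi n w)) = (\int[P]_w F w) * \int[nu]_z g z)%E.
Proof.
move=> mF F0 mg g0.
have mid : measurable_fun setT (idfun : Omega -> past n).
  by move=> _ B mB; rewrite setTI; exact: past_measurable mB.
pose X : {mfun Omega >-> past n} :=
  HB.pack (idfun : Omega -> past n) (isMeasurableFun.Build _ _ _ _ _ mid).
have mY : measurable_fun setT (xi n : Omega -> measurableTypeR R) by exact: mxi.
pose Y : {mfun Omega >-> measurableTypeR R} :=
  HB.pack (xi n : Omega -> measurableTypeR R)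
    (isMeasurableFun.Build _ _ _ _ _ mY).
apply: (@ge0_integral_independent R d Omega P _ (past n) _ _ X Y nu F g) => //.
by move=> A B mA mB; exact: past_indep.
Qed.

End past.

(** * Integration against a density, and the Gaussian exponential moment *)

Section density.
Context d (T : measurableType d) (R : realType).
Variables (mu nu : {measure set T -> \bar R}) (p : T -> R).
Hypotheses (mp : measurable_fun setT p) (p0 : forall x, 0 <= p x).
Hypothesis nuE : forall A, measurable A -> nu A = (\int[mu]_(x in A) (p x)%:E)%E.

Import HBNNSimple.

Let density_nnsfun (f : {nnsfun T >-> R}) :
  (\int[nu]_x (f x)%:E = \int[mu]_x ((f x)%:E * (p x)%:E))%E.
Proof.
under [LHS]eq_integral do rewrite fimfunE -fsumEFin//.
rewrite [LHS]ge0_integral_fsum//; last 2 first.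
  - by move=> r; exact/measurable_EFinP/measurableT_comp.
  - by move=> n x _; rewrite EFinM nnfun_muleindic_ge0.
under [RHS]eq_integral.
  move=> x xD; rewrite fimfunE -fsumEFin// muleC ge0_mule_fsumr; last first.
    by move=> r; rewrite EFinM; exact: nnfun_muleindic_ge0.
  over.
rewrite [RHS]ge0_integral_fsum//; last 2 first.
  - move=> r; apply: emeasurable_funM; apply/measurable_EFinP => //.
    exact/measurableT_comp.
  - move=> n x _; apply: mule_ge0; first by rewrite lee_fin.
    by rewrite EFinM; exact: nnfun_muleindic_ge0.
apply: eq_fsbigr => r _.
rewrite integralZl_indic_nnsfun//= integral_indic// setIT nuE//.
rewrite (integral_mkcond (f @^-1` [set r])) /=.
have [r0|r0] := leP 0 r; last first.
  have -> : f @^-1` [set r] = set0.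
    apply/seteqP; split => // x /= fxr.
    by move: r0; rewrite -fxr ltNge fun_ge0.
  rewrite integral0_eq ?mule0; last by move=> x _; rewrite patchE in_set0.
  by rewrite integral0_eq// => x _; rewrite indic0 mulr0 mule0.
rewrite -ge0_integralZl//; last 2 first.
  - by apply/(measurable_restrictT _ _).1 => //; apply/measurable_funTS/measurable_EFinP.
  - by move=> x _; rewrite patchE; case: ifP => // _; rewrite lee_fin.
apply: eq_integral => x _; rewrite patchE indicE.
by case: (x \in _); rewrite ?mulr1 ?mulr0 ?mule0// muleC.
Qed.

Lemma ge0_integral_density (f : T -> \bar R) :
  measurable_fun setT f -> (forall x, 0 <= f x)%E ->
  (\int[nu]_x f x = \int[mu]_x (f x * (p x)%:E))%E.
Proof.
move=> mf f0.
pose f_ := nnsfun_approx measurableT mf.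
transitivity (lim (\int[nu]_x (f_ n x)%:E @[n --> \oo])%E).
  rewrite -monotone_convergence//=.
  - apply: eq_integral => ? /[!inE] xD; apply/esym/cvg_lim => //=.
    exact: cvg_nnsfun_approx.
  - by move=> n; exact/measurable_EFinP/measurable_funTS.
  - by move=> n ? _; rewrite lee_fin.
  - by move=> ? _ ? ? mn; rewrite lee_fin; exact/lefP/nd_nnsfun_approx.
transitivity (lim (\int[mu]_x ((f_ n x)%:E * (p x)%:E) @[n --> \oo])%E).
  by apply: congr_lim; apply/funext => n /=; exact: density_nnsfun.
rewrite -monotone_convergence//=.
- apply: eq_integral => x _; apply/cvg_lim => //=.
  apply: cvgeZr => //; exact: cvg_nnsfun_approx.
- move=> n; apply: emeasurable_funM; apply/measurable_EFinP => //.
- by move=> n ? _; rewrite mule_ge0// lee_fin.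
- move=> x _ ? ? mn; apply: lee_wpmul2r; first by rewrite lee_fin.
  by rewrite lee_fin; exact/lefP/nd_nnsfun_approx.
Qed.

End density.

(** Completing the square: exp(theta z) times the centred density is exp(theta^2 s^2 / 2) times the
    density with mean theta s^2. *)
Lemma normal_prob_mgf (R : realType) (s theta : R) : s != 0 ->
  (\int[normal_prob 0 s]_z (expR (theta * z))%:E =
    (expR (theta ^+ 2 * s ^+ 2 / 2))%:E)%E.
Proof.
move=> s0.
rewrite (@ge0_integral_density _ _ _ lebesgue_measure _ (normal_pdf 0 s))//.
- transitivity (\int[lebesgue_measure]_z ((expR (theta ^+ 2 * s ^+ 2 / 2))%:E *
    (normal_pdf (theta * s ^+ 2) s z)%:E))%E; last first.
    rewrite ge0_integralZl//; first by rewrite integral_normal_pdf mule1.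
    - by apply/measurable_EFinP; exact: measurable_normal_pdf.
    - by move=> x _; rewrite lee_fin normal_pdf_ge0.
  apply: eq_integral => z _; rewrite -!EFinM !normal_pdfE// /normal_fun.
  rewrite !(mulrCA (expR _) (normal_peak s)) -!expRD; congr ((_ * expR _)%:E).
  by field.
- exact: measurable_normal_pdf.
- by move=> x; exact: normal_pdf_ge0.
- by apply/measurable_EFinP; apply: measurableT_comp => //; exact: measurable_funM.
Qed.

(** * Optional stopping along a grid *)

Section stopped_martingale.
Context {R : realType} {T : Type}.
Implicit Types (S : nat -> T -> R) (A : nat -> set R).

(** Here [v] stands for the variance of one step of the walk. *)
Definition exp_martingale (theta v : R) S k w : R :=
  expR (theta * S k w - theta ^+ 2 * (k%:R * v) / 2).

(** If no index below [K] qualifies, [find] returns the length [K], which acts as the horizon. The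
    target may move with the index, because a fixed level for the martingale is a moving level for
    the walk. *)
Definition stop_index A S (K : nat) (w : T) : nat :=
  find (fun i => `[< A i (S i w) >]) (iota 0 K).

Lemma stop_index_le A S K w : (stop_index A S K w <= K)%N.
Proof. by rewrite (leq_trans (find_size _ _))// size_iota. Qed.

Lemma stop_index_before A S K w i : (i < stop_index A S K w)%N -> ~ A i (S i w).
Proof.
move=> ilt; have iK := leq_trans ilt (stop_index_le A S K w).
have := before_find 0%N ilt; rewrite nth_iota// add0n => /negbT/asboolPn.
exact.
Qed.

Lemma stop_index_lt A S K w : (stop_index A S K w < K)%N ->
  A (stop_index A S K w) (S (stop_index A S K w) w).
Proof.
move=> lt; have h : has (fun i => `[< A i (S i w) >]) (iota 0 K).
  by rewrite has_find size_iota.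
by have := nth_find 0%N h; rewrite nth_iota// add0n => /asboolP.
Qed.

(** At horizon [K] a first hit at [K] and no hit at all give the same index [K]. Hence the walk goes
    on to [K.+1] only if it has avoided its targets up to [K] included. *)
Lemma stop_indexS A S K w :
  stop_index A S K.+1 w =
  if `[< forall i, (i <= K)%N -> ~ A i (S i w) >] then K.+1
  else stop_index A S K w.
Proof.
rewrite /stop_index -[K.+1]addn1 iotaD add0n find_cat size_iota /=.
set p := fun i : nat => _; case: ifPn => [h|/hasPn hn].
  case: asboolP => // hA; exfalso; move/hasP: h => [i].
  by rewrite mem_iota add0n /= => iK /asboolP; apply: hA; exact: ltnW.
have fK : find p (iota 0 K) = K.
  by rewrite hasNfind ?size_iota//; apply/hasPn.
case: (asboolP (forall i, (i <= K)%N -> ~ A i (S i w))) => hA.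
  have -> : `[< A K (S K w) >] = false by apply/negbTE/asboolPn; exact: hA.
  by rewrite addn1.
have -> : `[< A K (S K w) >] = true; last by rewrite addn0.
apply/asboolP; apply: contrapT => pK; apply: hA => i.
rewrite leq_eqVlt => /predU1P[->//|iK].
by apply/asboolPn/hn; rewrite mem_iota.
Qed.

Lemma stop_index_alive A S K w : (forall i, (i <= K)%N -> ~ A i (S i w)) ->
  stop_index A S K w = K.
Proof.
move=> h; apply/eqP; rewrite eqn_leq stop_index_le leqNgt; apply/negP => lt.
by have := stop_index_lt lt; apply: h; exact: stop_index_le.
Qed.

Definition stopped_martingale theta v A S K w : R :=
  exp_martingale theta v S (stop_index A S K w) w.

Lemma stopped_martingale_gt0 theta v A S K w :
  0 < stopped_martingale theta v A S K w.
Proof. exact: expR_gt0. Qed.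

End stopped_martingale.

Section expectation_stopped.
Context {R : realType} {d : measure_display} {Omega : measurableType d}.
Variables (P : probability Omega R) (xi : nat -> Omega -> R) (s : R).
Hypothesis s_neq0 : s != 0.
Hypothesis mxi : forall i, measurable_fun setT (xi i).
Hypothesis xi_law : forall i (B : set R), measurable B ->
  P (xi i @^-1` B) = normal_prob 0 s B.
Hypothesis xi_indep : forall (n : nat) (B : nat -> set R),
  (forall i, measurable (B i)) ->
  P [set w | forall i, (i < n)%N -> B i (xi i w)] =
  (\prod_(i < n) P (xi i @^-1` B i))%E.

Variables (theta y : R) (A : nat -> set R).
Hypothesis mA : forall i, measurable (A i).

Let S k w : R := y + \sum_(i < k) xi i w.
Let v : R := s ^+ 2.
Let M := exp_martingale theta v S.
Let U := stopped_martingale theta v A S.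
Let alive K := [set w | forall i, (i <= K)%N -> ~ A i (S i w)].

Let measurable_S n k : (k <= n)%N -> measurable_fun (setT : set (past xi n)) (S k).
Proof.
move=> kn; apply: measurable_funD => //.
apply: measurable_sum => i; apply: measurable_xi_past.
exact: leq_trans (ltn_ord i) kn.
Qed.

Let measurable_M n k : (k <= n)%N -> measurable_fun (setT : set (past xi n)) (M k).
Proof.
move=> kn; apply: measurableT_comp => //; apply: measurable_funB => //.
by apply: measurable_funM => //; exact: measurable_S.
Qed.

Let measurable_alive n k : (k <= n)%N -> measurable (alive k : set (past xi n)).
Proof.
move=> kn.
have -> : alive k = \bigcap_(i in `I_k.+1) (S i @^-1` (~` A i)).
  by apply/seteqP; split => w /=.
apply: fin_bigcap_measurable => // i /= ik.
rewrite -[X in measurable X]setTI; apply: measurable_S => //.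
  by apply: leq_trans kn; rewrite -ltnS.
exact: measurableC.
Qed.

Let US K w : U K.+1 w = if w \in alive K then M K.+1 w else U K w.
Proof.
rewrite /U /stopped_martingale stop_indexS.
case: asboolP => h; first by rewrite ifT// inE.
by rewrite ifN// notin_setE.
Qed.

Let U_alive K w : w \in alive K -> U K w = M K w.
Proof. by rewrite inE /U /stopped_martingale => h; rewrite stop_index_alive. Qed.

Let measurable_U n k : (k <= n)%N -> measurable_fun (setT : set (past xi n)) (U k).
Proof.
elim: k => [|k IH] kn; first exact: (@measurable_M n 0).
have -> : U k.+1 = fun w => if w \in alive k then M k.+1 w else U k w.
  by apply/funext => w; rewrite US.
apply: measurable_fun_ifT.
- apply: (@measurable_fun_bool _ _ _ _ true).
  have -> : (fun w => w \in alive k) @^-1` [set true] = alive k.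
    by apply/seteqP; split => w; [move/set_mem|move/mem_set].
  by rewrite setTI; exact: measurable_alive (ltnW kn).
- exact: measurable_M.
- exact: IH (ltnW kn).
Qed.

Lemma measurable_stopped_martingale K : measurable_fun setT (U K).
Proof. by apply: (past_measurable_fun mxi); exact: (measurable_U (leqnn K)). Qed.

(** From [K] to [K.+1] the stopped martingale changes only where the walk is alive, by the factor
    exp(theta xi - theta^2 v / 2). Being alive is an event of the past, the new increment is
    independent of it, and the factor has mean 1. *)
Lemma expectation_stopped_martingale K :
  (\int[P]_w (U K w)%:E = (expR (theta * y))%:E)%E.
Proof.
elim: K => [|K IH].
  under eq_integral => w _.
    rewrite /U /stopped_martingale /stop_index /= /exp_martingale.
    rewrite mul0r mulr0 mul0r subr0 /S big_ord0 addr0.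
    over.
  by rewrite integral_cst//= probability_setT mule1.
have malive : measurable (alive K).
  by apply: (past_measurable mxi); exact: measurable_alive (leqnn K).
have malive' := @measurable_alive K K (leqnn K).
have mU := @measurable_U K K (leqnn K).
rewrite -IH.
have split_ : forall w, (U K.+1 w)%:E =
   ((U K w * \1_(~` alive K) w)%:E + (U K w * \1_(alive K) w)%:E *
     (expR (theta * xi K w - theta ^+ 2 * v / 2))%:E)%E.
  move=> w; rewrite US !indicE in_setC; have [wa|wa] := boolP (w \in _) => /=.
    rewrite mulr0 mulr1 add0e U_alive// -EFinM; congr (_%:E).
    rewrite /M /exp_martingale -expRD /S big_ord_recr /=; congr expR.
    by rewrite -natr1; ring.
  by rewrite mulr0 mul0e adde0 mulr1.
under eq_integral do rewrite split_.
have mU1 B : measurable (B : set (past xi K)) ->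
    measurable_fun (setT : set (past xi K)) (fun w => (U K w * \1_B w)%:E).
  move=> mB; apply/measurable_EFinP; apply: measurable_funM => //.
have U10 B w : (0 <= (U K w * \1_B w)%:E)%E.
  by rewrite lee_fin mulr_ge0// ltW// stopped_martingale_gt0.
have mg : measurable_fun setT
    (fun z : R => (expR (theta * z - theta ^+ 2 * v / 2))%:E).
  apply/measurable_EFinP; apply: measurableT_comp => //.
  by apply: measurable_funB => //; exact: measurable_funM.
rewrite ge0_integralD//; last 3 first.
- by apply: (past_measurable_fun mxi); apply: mU1; exact: measurableC.
- by move=> w _; rewrite mule_ge0// lee_fin expR_ge0.
- apply: emeasurable_funM; first exact: (past_measurable_fun mxi (mU1 _ malive')).
  exact: measurableT_comp mg (mxi K).
rewrite (@ge0_integral_past _ _ _ P xi (normal_prob 0 s) mxi xi_law xi_indep K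
  (fun w => (U K w * \1_(alive K) w)%:E)
  (fun z => (expR (theta * z - theta ^+ 2 * v / 2))%:E))//; last exact: mU1.
have -> : (\int[normal_prob 0 s]_z
    (expR (theta * z - theta ^+ 2 * v / 2))%:E = 1)%E.
  under eq_integral do rewrite expRD mulrC EFinM.
  rewrite ge0_integralZl//; last first.
    by apply/measurable_EFinP; apply: measurableT_comp.
  by rewrite normal_prob_mgf// -EFinM -expRD addNr expR0.
rewrite mule1 -ge0_integralD//; last 2 first.
- by apply: (past_measurable_fun mxi); apply: mU1; exact: measurableC.
- exact: (past_measurable_fun mxi (mU1 _ malive')).
apply: eq_integral => w _; rewrite -EFinD -mulrDr !indicE in_setC.
by case: (w \in _); rewrite ?addr0 ?add0r mulr1.
Qed.

End expectation_stopped.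

(** * Dyadic times *)

Section dyadic.
Context {R : realType}.

Definition dyadic (n i : nat) : R := i%:R * (2 ^+ n)^-1.

Lemma dyadic_ge0 n i : 0 <= dyadic n i.
Proof. by rewrite mulr_ge0// invr_ge0 exprn_ge0. Qed.

Lemma dyadic_refine n m i : (n <= m)%N -> dyadic n i = dyadic m (i * 2 ^ (m - n)).
Proof.
move=> nm; move: (m - n)%N (subnK nm) => k <-.
rewrite /dyadic natrM natrX exprD invfM -mulrA mulVKf// expf_neq0.
Qed.

Lemma ltr_exp2n (x : R) : exists N, forall n, (N <= n)%N -> x < 2 ^+ n.
Proof.
exists (Num.truncn `|x|).+1 => n Nn; rewrite (le_lt_trans (ler_norm _))//.
rewrite (lt_le_trans (truncnS_gt _))// -natrX ler_nat (leq_trans Nn)//.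
exact/ltnW/ltn_expl.
Qed.

Lemma dyadic_between (a b : R) : 0 <= a -> a < b ->
  exists N, forall n, (N <= n)%N -> exists i, a < dyadic n i < b.
Proof.
move=> a0 ab; have [N HN] := ltr_exp2n (b - a)^-1.
exists N => n /HN H; exists (Num.truncn (a * 2 ^+ n)).+1.
have e0 : 0 < 2 ^+ n :> R by rewrite exprn_gt0.
rewrite /dyadic ltr_pdivlMr// ltr_pdivrMr// truncnS_gt/=.
have : (Num.truncn (a * 2 ^+ n))%:R <= a * 2 ^+ n.
  by rewrite truncn_le// mulr_ge0// ltW.
have ba0 : 0 < b - a by rewrite subr_gt0.
move: H; rewrite invf_plt ?posrE// => H.
have : 1 < (b - a) * 2 ^+ n by rewrite -ltr_pdivrMr// div1r.
by rewrite -natr1 mulrBl; lra.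
Qed.

Lemma continuous_dyadic_le0 (g : R -> R) : {within `[0, +oo[, continuous g} ->
  (forall n i, g (dyadic n i) <= 0) -> forall t, 0 <= t -> g t <= 0.
Proof.
move=> /subspace_continuousP gc gd t t0; rewrite leNgt; apply/negP => gt0.
have /gc : `[0, +oo[%classic t by rewrite /= in_itv/= t0.
move=> /cvgr_gt /(_ 0 gt0); rewrite near_withinE => /nbhs_ballP[e/= e0 He].
have te : t < t + e by rewrite ltrDl.
have [N /(_ N (leqnn N)) [i /andP[i1 i2]]] := dyadic_between t0 te.
have := gd N i; apply/negP; rewrite -ltNge; apply: He.
  by rewrite /ball/= distrC ger0_norm; lra.
by rewrite /= in_itv/= dyadic_ge0.
Qed.

End dyadic.

Section brownian_grid.
Context {R : realType} {d : measure_display} {Omega : measurableType d}.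
Variables (P : probability Omega R) (W : R -> Omega -> R).
Hypothesis hW : brownian_motion P W.
Variables (Delta : R).
Hypothesis Delta0 : 0 < Delta.

(** [W 0] is subtracted because it vanishes only almost surely. *)
Definition grid_walk (y : R) (k : nat) (w : Omega) : R :=
  y + (W (k%:R * Delta) w - W 0 w).

Let xi (i : nat) (w : Omega) := W (i.+1%:R * Delta) w - W (i%:R * Delta) w.
Let s := Num.sqrt Delta.

Let time_ge0 (i : nat) : 0 <= i%:R * Delta.
Proof. by rewrite mulr_ge0// ltW. Qed.

Let time_lt (i : nat) : i%:R * Delta < i.+1%:R * Delta.
Proof. by rewrite ltr_pM2r// ltr_nat. Qed.

Let mxi i : measurable_fun setT (xi i).
Proof. by apply: measurable_funB; apply: (bm_measurable hW). Qed.

Let xi_law i (B : set R) : measurable B -> P (xi i @^-1` B) = normal_prob 0 s B.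
Proof.
move=> mB; rewrite /s; have -> : Delta = i.+1%:R * Delta - i%:R * Delta.
  by rewrite -natr1; ring.
exact: (bm_gaussian hW (time_ge0 i) (time_lt i)).
Qed.

Let xi_indep (n : nat) (B : nat -> set R) : (forall i, measurable (B i)) ->
  P [set w | forall i, (i < n)%N -> B i (xi i w)] =
  (\prod_(i < n) P (xi i @^-1` B i))%E.
Proof.
move=> mB; apply: (@bm_independent _ _ _ _ _ hW n (fun i => i%:R * Delta)) => //.
by move=> i; exact/ltW.
Qed.

Let grid_walkE y : grid_walk y = fun k w => y + \sum_(i < k) xi i w.
Proof.
apply/funext => k; apply/funext => w; rewrite /grid_walk; congr (_ + _).
transitivity (\sum_(0 <= i < k) xi i w); last by rewrite big_mkord.
by rewrite (telescope_sumr (fun i => W (i%:R * Delta) w))// mul0r.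
Qed.

Let s_neq0 : s != 0. Proof. by rewrite gt_eqF// sqrtr_gt0. Qed.
Let s2E : s ^+ 2 = Delta. Proof. by rewrite sqr_sqrtr// ltW. Qed.

Lemma brownian_stopped_martingale theta y A K : (forall i, measurable (A i)) ->
  (\int[P]_w (stopped_martingale theta Delta A (grid_walk y) K w)%:E =
    (expR (theta * y))%:E)%E.
Proof.
move=> mA; rewrite grid_walkE -s2E.
exact: (expectation_stopped_martingale s_neq0 mxi xi_law xi_indep).
Qed.

Lemma measurable_brownian_stopped theta y A K : (forall i, measurable (A i)) ->
  measurable_fun setT (stopped_martingale theta Delta A (grid_walk y) K).
Proof.
move=> mA; rewrite grid_walkE.
by have := measurable_stopped_martingale s mxi theta y mA K; rewrite s2E.
Qed.

End brownian_grid.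

(** * Almost sure behaviour of the paths *)

Section path_properties.
Context {R : realType} {d : measure_display} {Omega : measurableType d}.
Variables (P : probability Omega R) (W : R -> Omega -> R).
Hypothesis hW : brownian_motion P W.

Lemma probability_le_all0 (N : set Omega) :
  (forall e : R, 0 < e -> (P N <= e%:E)%E) -> P N = 0%E.
Proof.
move=> H; apply/eqP; rewrite eq_le measure_ge0 andbT.
by apply/lee_addgt0Pr => e e0; rewrite add0e; exact: H.
Qed.

(** * A maximal inequality along dyadic times *)

Section maximal.
Variable theta : R.

Let G n i w := expR (theta * (W (dyadic n i) w - W 0 w) -
  theta ^+ 2 * dyadic n i / 2).
(** The grid of level [n] has mesh 2^-n and runs up to time [n], so that these grids increase and
    exhaust the dyadic times. *)
Let K n := (n * 2 ^ n)%N.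
Let E C n := [set w | exists2 i, (i < K n)%N & C < G n i w].

Let mG n i : measurable_fun setT (G n i).
Proof.
apply: measurableT_comp => //; apply: measurable_funB => //.
apply: measurable_funM => //; apply: measurable_funB; apply: (bm_measurable hW) => //.
exact: dyadic_ge0.
Qed.

Let mE C n : measurable (E C n).
Proof.
have -> : E C n = \bigcup_(i in `I_(K n)) (G n i @^-1` `]C, +oo[).
  apply/seteqP; split => w [i /= iK].
    by move=> CG; exists i => //=; rewrite in_itv/= CG.
  by rewrite in_itv/= andbT => CG; exists i.
apply: bigcup_measurable => i _; rewrite -[X in measurable X]setTI.
exact: mG.
Qed.

(** Doob's inequality: stopped when it first exceeds [C], the martingale is above [C] on [E C n] and
    still has mean 1. *)
Let PE C n : 0 < C -> (P (E C n) <= (C^-1)%:E)%E.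
Proof.
move=> C0.
pose A (i : nat) := [set z : R | C < expR (theta * z -
  theta ^+ 2 * (i%:R * (2 ^+ n)^-1) / 2)].
have mA i : measurable (A i).
  have -> : A i = (fun z => expR (theta * z -
      theta ^+ 2 * (i%:R * (2 ^+ n)^-1) / 2)) @^-1` `]C, +oo[.
    by apply/seteqP; split => z /=; rewrite in_itv/= andbT.
  rewrite -[X in measurable X]setTI.
  have : measurable_fun setT (fun z : R => expR (theta * z -
      theta ^+ 2 * (i%:R * (2 ^+ n)^-1) / 2)).
    by apply: measurableT_comp => //; apply: measurable_funB => //; exact: measurable_funM.
  exact.
have D0 : 0 < (2 ^+ n : R)^-1 by rewrite invr_gt0 exprn_gt0.
have mU := measurable_brownian_stopped hW D0 theta 0 (K n) mA.
have EU := brownian_stopped_martingale hW D0 theta 0 (K n) mA.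
set U := stopped_martingale _ _ _ _ _ in mU EU.
have EU_ w : E C n w -> C < U w.
  move=> [i iK CG].
  suff : (stop_index A (grid_walk W (2 ^+ n)^-1 0) (K n) w < K n)%N.
    by move=> lt; exact: (stop_index_lt lt).
  rewrite ltnNge; apply/negP => Kle.
  apply: (stop_index_before (leq_trans iK Kle)).
  by move: CG; rewrite /G /A /grid_walk /dyadic /= add0r.
rewrite -[leRHS]mule1 lee_pdivlMl// -integral_cst//.
rewrite -(_ : (expR (theta * 0))%:E = 1%E); last by rewrite mulr0 expR0.
rewrite -EU; apply: (@le_trans _ _ (\int[P]_(w in E C n) (U w)%:E)%E).
  apply: ge0_le_integral => //=.
  - by move=> w _; rewrite lee_fin ltW.
  - by apply: measurable_funTS; exact/measurable_EFinP.
  - by move=> w Ew; rewrite lee_fin ltW// EU_.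
apply: ge0_subset_integral => //=; first exact/measurable_EFinP.
by move=> w _; rewrite lee_fin ltW// stopped_martingale_gt0.
Qed.

Let E_nd C : {homo E C : n m / (n <= m)%N >-> (n <= m)%O}.
Proof.
move=> n m nm; apply/subsetPset => w [i iK CG].
exists (i * 2 ^ (m - n))%N; last by rewrite /G -dyadic_refine.
rewrite /K -(subnK nm) addnK expnD [leqRHS]mulnCA [leqRHS]mulnC.
rewrite ltn_pmul2r ?expn_gt0//; apply: leq_trans iK _.
by rewrite leq_mul2r leq_addl orbT.
Qed.

Let E_full C n i w : C < G n i w -> exists m, E C m w.
Proof.
move=> CG; pose m := maxn n i.+1; exists m; exists (i * 2 ^ (m - n))%N.
  have nm : (n <= m)%N by exact: leq_maxl.
  apply: (@leq_trans (m * 2 ^ (m - n)))%N.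
    by rewrite ltn_pmul2r ?expn_gt0// leq_maxr.
  by rewrite /K leq_mul2l leq_exp2l// leq_subr orbT.
by rewrite /G -dyadic_refine// leq_maxl.
Qed.

(** As [E C n] increases with [n], the level [C] is exceeded at some dyadic time with probability at
    most 1 / C, which tends to 0 along C = k + 1. *)
Lemma dyadic_exp_martingale_bounded :
  {ae P, forall w, exists C, forall n i,
    expR (theta * (W (dyadic n i) w - W 0 w) -
      theta ^+ 2 * dyadic n i / 2) <= C}.
Proof.
have mUE C : measurable (\bigcup_n E C n) by exact: bigcup_measurable.
exists (\bigcap_k \bigcup_n E k.+1%:R n); split.
- exact: bigcap_measurable.
- apply: probability_le_all0 => e e0.
  pose k := Num.truncn e^-1.
  have ke : k.+1%:R^-1 <= e.
    by rewrite invf_ple ?posrE// ltW// truncnS_gt.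
  apply: (@le_trans _ _ (P (\bigcup_n E k.+1%:R n))).
    apply: le_measure; rewrite ?inE//; first exact: bigcap_measurable.
    by move=> w; apply.
  have cv := nondecreasing_cvg_mu (mu := P) (mE k.+1%:R) (mUE _) (@E_nd k.+1%:R).
  rewrite -(cvg_lim _ cv)//; apply: lime_le; first exact: cvgP cv.
  apply: nearW => n /=; apply: (le_trans (PE n _)) => //.
- move=> w /= /forallNP H k _; have /existsNP[n /existsNP[i]] := H k.+1%:R.
  by move=> /negP; rewrite -ltNge => /E_full[m ?]; exists m.
Qed.

End maximal.

Lemma normal_prob_centered_le (s m : R) : s != 0 -> 0 <= m ->
  (normal_prob 0 s `[(- m)%R, m] <= (normal_peak s * (2 * m))%:E)%E.
Proof.
move=> s0 m0; rewrite /normal_prob.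
apply: (@le_trans _ _ (\int[lebesgue_measure]_(x in `[(- m)%R, m]) (normal_peak s)%:E)%E).
  apply: ge0_le_integral => //=.
  - by move=> x _; rewrite lee_fin normal_pdf_ge0.
  - by apply/measurable_EFinP/measurable_funTS; exact: measurable_normal_pdf.
  - by move=> x _; rewrite lee_fin normal_pdf_ub.
rewrite integral_cst//= lebesgue_measure_itv/= lte_fin.
case: ifPn => _; last by rewrite mule0 lee_fin !mulr_ge0 ?normal_peak_ge0.
by rewrite -EFinD -EFinM lee_fin opprK mulrDl !mul1r.
Qed.

(** At the integer time k the increment lies in [-m, m] with probability at most 2 m / sqrt(2 pi k),
    and this tends to 0. *)
Lemma brownian_unbounded :
  {ae P, forall w, forall m : nat, exists2 t, 0 <= t & m%:R < `|W t w - W 0 w|}.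
Proof.
apply: ae_foralln => m.
pose B (k : nat) := [set w | `[- m%:R, m%:R]%classic (W k%:R w - W 0 w)].
have mB k : measurable (B k).
  rewrite -[X in measurable X]setTI.
  by apply: (measurable_funB (bm_measurable hW (ler0n _ _)) (bm_measurable hW (lexx _))).
exists (\bigcap_k B k.+1); split.
- exact: bigcap_measurable.
- apply: probability_le_all0 => e e0.
  pose k := Num.truncn ((2 * m%:R / e) ^+ 2).
  apply: (@le_trans _ _ (P (B k.+1))).
    apply: le_measure; rewrite ?inE//; first exact: bigcap_measurable.
    by move=> w; apply.
  rewrite /B (bm_gaussian hW)// subr0.
  have s0 : Num.sqrt k.+1%:R != 0 :> R by rewrite gt_eqF// sqrtr_gt0.
  apply: (le_trans (normal_prob_centered_le s0 (ler0n _ _))).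
  rewrite lee_fin /normal_peak sqr_sqrtr// mulrC ler_pdivrMr; last first.
    by rewrite sqrtr_gt0 mulrn_wgt0// mulr_gt0// pi_gt0.
  apply: (@le_trans _ _ (e * Num.sqrt ((2 * m%:R / e) ^+ 2))).
    rewrite sqrtr_sqr ger0_norm; last by rewrite divr_ge0 ?mulr_ge0// ltW.
    by rewrite [leRHS]mulrC divfK// gt_eqF.
  apply: ler_wpM2l; first exact: ltW.
  rewrite ler_wsqrtr//; apply: (@le_trans _ _ k.+1%:R).
    by rewrite ltW// truncnS_gt.
  rewrite -mulrnAr ler_peMr// mulr2n.
  by have := pi_ge2 R; lra.
- move=> w /= H k _; rewrite /B /= in_itv/= -ler_norml leNgt; apply/negP => lt.
  by apply: H; exists k.+1%:R.
Qed.

End path_properties.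

(** All that the pathwise arguments use. Unboundedness makes exit times finite; sublinear growth
    makes the discounted payoff vanish at infinity; continuity on the whole line avoids one-sided
    limits at 0. *)
Definition tame_path (R : realType) (g : R -> R) : Prop :=
  [/\ g 0 = 0, continuous g,
      forall m : nat, exists2 t, 0 <= t & m%:R < `|g t| &
      forall e, 0 < e -> exists C, forall t, 0 <= t -> `|g t| <= C + e * t].

Section tame_modification.
Context {R : realType}.

(** A deterministic tame path, to be put in place of the bad paths of the motion. The constant 1 / e
    in its sublinear bound comes from (e x - 1)^2 >= 0, where x is the root of t. *)
Lemma tame_sqrt : tame_path (@Num.sqrt R).
Proof.
split.
- exact: sqrtr0.
- by move=> x; exact: sqrt_continuous.
- move=> m; exists (m.+1%:R ^+ 2); first exact: sqr_ge0.
  by rewrite sqrtr_sqr normr_id ger0_norm// ltr_nat.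
- move=> e e0; exists e^-1 => t t0; rewrite ger0_norm ?sqrtr_ge0//.
  rewrite -{2}(sqr_sqrtr t0); set x := Num.sqrt t.
  rewrite -(@ler_pM2l _ e)// mulrDr divff ?gt_eqF//.
  have : 0 <= (e * x - 1) ^+ 2 by exact: sqr_ge0.
  have : 0 <= e * x by rewrite mulr_ge0 ?sqrtr_ge0// ltW.
  have -> : e * (e * x ^+ 2) = (e * x) ^+ 2 by ring.
  set z := e * x; rewrite sqrrB1; nra.
Qed.

Lemma continuous_max0 (g : R -> R) : {within `[0, +oo[, continuous g} ->
  continuous (fun t : R => g (Num.max 0 t)).
Proof.
move=> /subspace_continuousP gc t.
have m0 (x : R) : `[0, +oo[%classic (Num.max 0 x).
  have h : 0 <= Num.max 0 x by rewrite le_max lexx.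
  by rewrite /= in_itv/= h.
apply: (cvg_trans _ (gc _ (m0 t))) => A.
rewrite /= near_simpl /within /= => HA.
have mc : {for t, continuous (fun x : R => Num.max 0 x)}.
  apply: (@continuous_max R R (cst 0) id); [exact: cst_continuous|exact: cvg_id].
have := mc _ HA; rewrite /= nbhs_simpl /=.
by apply: filterS => x /=; apply; exact: m0.
Qed.

(** With th = 1 / (m + 1), a bound C on the exponential martingale reads th g(t) <= ln C + th^2 t /
    2 at dyadic times, hence at all times by continuity. Division by th leaves the slope th / 2, as
    small as desired; the parameter - th bounds the path from below. *)
Lemma tame_pathP (g : R -> R) : g 0 = 0 -> {within `[0, +oo[, continuous g} ->
  (forall m : nat, exists2 t, 0 <= t & m%:R < `|g t - g 0|) ->
  (forall m, exists C, forall n i,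
    expR (m.+1%:R^-1 * (g (dyadic n i) - g 0) - m.+1%:R^-1 ^+ 2 * dyadic n i / 2) <= C) ->
  (forall m, exists C, forall n i,
    expR (- m.+1%:R^-1 * (g (dyadic n i) - g 0)
          - (- m.+1%:R^-1) ^+ 2 * dyadic n i / 2) <= C) ->
  tame_path (fun t : R => g (Num.max 0 t)).
Proof.
move=> g0 gc gu gp gn.
have key (th : R) C : (forall n i,
    expR (th * (g (dyadic n i) - g 0) - th ^+ 2 * dyadic n i / 2) <= C) ->
    forall t, 0 <= t -> th * g t <= ln C + th ^+ 2 / 2 * t.
  move=> H t t0; rewrite -subr_le0.
  apply: (@continuous_dyadic_le0 _ (fun t => th * g t - (ln C + th ^+ 2 / 2 * t))) => //.
    move=> x; apply: cvgB; first by apply: cvgM; [exact: cvg_cst|exact: gc].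
    have c2 : continuous (fun x : R => ln C + th ^+ 2 / 2 * x).
      move=> z; apply: cvgD; first exact: cvg_cst.
      by apply: cvgM; [exact: cvg_cst|exact: cvg_id].
    exact: (continuous_subspaceT c2).
  move=> n i; have := H n i; rewrite g0 subr0 => H1.
  have C0 : 0 < C by apply: lt_le_trans H1; exact: expR_gt0.
  move: H1; rewrite -[X in _ <= X -> _]lnK ?posrE// ler_expR => H1.
  rewrite subr_le0; move: H1; lra.
split.
- by rewrite maxxx.
- exact: continuous_max0.
- move=> m; have [t t0 H] := gu m; exists t => //.
  by rewrite max_r//; move: H; rewrite g0 subr0.
- move=> e e0; pose m := Num.truncn e^-1.
  have me : m.+1%:R^-1 <= e by rewrite invf_ple ?posrE// ltW// truncnS_gt.
  have [C1 /key H1] := gp m; have [C2 /key H2] := gn m.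
  set th := m.+1%:R^-1 in me H1 H2.
  have th0 : 0 < th by rewrite invr_gt0.
  exists (`|ln C1| / th + `|ln C2| / th) => t t0; rewrite max_r//.
  rewrite ler_norml; apply/andP; split.
    rewrite -(@ler_pM2l _ th)// mulrN mulrDr mulrDr mulrCA divff ?gt_eqF// mulr1.
    rewrite mulrCA divff ?gt_eqF// mulr1.
    have := H2 t t0; rewrite sqrrN mulNr => H.
    have := ler_norm (ln C2); have := normr_ge0 (ln C1).
    have : th ^+ 2 / 2 * t <= th * (e * t).
      rewrite mulrA ler_wpM2r// expr2.
      have := ler_wpM2l (ltW th0) me; have := mulr_gt0 th0 th0; lra.
    lra.
  rewrite -(@ler_pM2l _ th)// mulrDr mulrDr mulrCA divff ?gt_eqF// mulr1.
  rewrite mulrCA divff ?gt_eqF// mulr1.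
  have H := H1 t t0.
  have := ler_norm (ln C1); have := normr_ge0 (ln C2).
  have : th ^+ 2 / 2 * t <= th * (e * t).
    rewrite mulrA ler_wpM2r// expr2.
    have := ler_wpM2l (ltW th0) me; have := mulr_gt0 th0 th0; lra.
  lra.
Qed.

Context {d : measure_display} {Omega : measurableType d}.
Variables (P : probability Omega R) (W : R -> Omega -> R).
Hypothesis hW : brownian_motion P W.

Lemma measure_eq_outside (A B N : set Omega) :
  measurable A -> measurable B -> measurable N -> P N = 0%E ->
  (forall w, ~ N w -> A w <-> B w) -> P A = P B.
Proof.
move=> mA mB mN N0 AB.
have H C D : measurable C -> measurable D ->
    (forall w, ~ N w -> C w -> D w) -> (P C <= P D)%E.
  move=> mC mD CD; apply: (@le_trans _ _ (P (D `|` N))).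
    apply: le_measure; rewrite ?inE//; first exact: measurableU.
    by move=> w Cw; have [Nw|Nw] := pselect (N w); [right|left; exact: CD].
  by have := @measureU2 _ _ _ P D N mD mN; rewrite /= [X in (_ + X)%E]N0 adde0.
by apply/eqP; rewrite eq_le !H// => w Nw; case: (AB w Nw).
Qed.

(** At nonnegative times the paths change only on a null set, so the probabilities in the definition
    are preserved. With every path tame, exit times are finite and measurable without exception. *)
Lemma brownian_tame_modification : exists W' : R -> Omega -> R,
  [/\ brownian_motion P W', forall w, tame_path (W' ^~ w) &
      {ae P, forall w, forall t : R, 0 <= t -> W' t w = W t w}].
Proof.
have [N [mN N0 HN]] : {ae P, forall w, tame_path (fun t : R => W (Num.max 0 t) w)}.
  have a1 := bm_start hW.
  have a2 := bm_continuous hW.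
  have a3 := brownian_unbounded hW.
  have a4 := ae_foralln (fun m => dyadic_exp_martingale_bounded hW m.+1%:R^-1).
  have a5 := ae_foralln (fun m => dyadic_exp_martingale_bounded hW (- m.+1%:R^-1)).
  apply: filterS3 (filterI a1 a2) a3 (filterI a4 a5) => w [? ?] ? [? ?].
  exact: (@tame_pathP (W ^~ w)).
(* Off [N] negative times are frozen at 0, which turns continuity on the half-line into continuity
   on the line. *)
pose W' (t : R) (w : Omega) : R := if w \in N then Num.sqrt t else W (Num.max 0 t) w.
have W'E (t : R) w : 0 <= t -> ~ N w -> W' t w = W t w.
  by move=> t0 Nw; rewrite /W' memNset// max_r.
have mW' (t : R) : 0 <= t -> measurable_fun setT (W' t).
  move=> t0; apply: measurable_fun_ifT.
  - apply: (@measurable_fun_bool _ _ _ _ true).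
    have -> : (fun w => w \in N) @^-1` [set true] = N.
      by apply/seteqP; split => w; [move/set_mem|move/mem_set].
    by rewrite setTI.
  - exact: measurable_cst.
  - by rewrite max_r//; exact: bm_measurable hW _ t0.
have mincr (V : R -> Omega -> R) (s t : R) (B : set R) : (forall t : R, 0 <= t -> measurable_fun setT (V t)) ->
    0 <= s -> 0 <= t -> measurable B -> measurable [set w | B (V t w - V s w)].
  move=> mV s0 t0 mB; rewrite -[X in measurable X]setTI.
  by apply: (measurable_funB (mV _ t0) (mV _ s0)).
exists W'; split.
- split.
  + exact: mW'.
  + exists N; split => // w /= H; apply: contrapT => Nw; apply: H.
    rewrite W'E//; apply: contrapT => W0; apply: Nw; apply: HN => /= -[].
    by rewrite maxxx.
  + exists N; split => // w /= H; apply: contrapT => Nw; apply: H.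
    have [_ cW _ _] : tame_path (fun t : R => W (Num.max 0 t) w).
      by apply: contrapT => ?; apply: Nw; exact: HN.
    have -> : (fun t => W' t w) = fun t => W (Num.max 0 t) w.
      by apply/funext => t; rewrite /W' memNset.
    exact: continuous_subspaceT.
  + move=> s t B s0 st mB; have t0 := le_trans s0 (ltW st).
    rewrite -(bm_gaussian hW s0 st mB); apply: (measure_eq_outside _ _ mN N0).
    * exact: mincr.
    * exact: (mincr W s t B (bm_measurable hW)).
    * by move=> w Nw /=; rewrite !W'E.
  + move=> n t B t0 tt mB.
    have ti0 i : 0 <= t i by elim: i => // i IH; exact: le_trans IH (tt i).
    have mcap (V : R -> Omega -> R) : (forall t : R, 0 <= t -> measurable_fun setT (V t)) ->
        measurable [set w | forall i, (i < n)%N -> B i (V (t i.+1) w - V (t i) w)].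
      move=> mV; have -> : [set w | forall i, (i < n)%N -> B i (V (t i.+1) w - V (t i) w)] =
          \bigcap_(i in `I_n) [set w | B i (V (t i.+1) w - V (t i) w)].
        by apply/seteqP; split => w.
      apply: fin_bigcap_measurable => // i _.
      exact: (mincr _ _ _ _ mV (ti0 i) (ti0 i.+1) (mB i)).
    transitivity (\prod_(i < n) P [set w | B i (W (t i.+1) w - W (t i) w)%R])%E.
      rewrite -[RHS](@bm_independent _ _ _ _ _ hW n t B t0 tt mB).
      apply: (measure_eq_outside _ _ mN N0).
      * exact: mcap.
      * exact: (mcap W (bm_measurable hW)).
      * move=> w Nw /=; split => H i ni; have := H i ni; by rewrite !W'E.
    apply: eq_bigr => i _; apply: (measure_eq_outside _ _ mN N0).
    * exact: (mincr _ _ _ _ (bm_measurable hW) (ti0 i) (ti0 i.+1) (mB i)).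
    * exact: (mincr W' (t i) (t i.+1) (B i) mW').
    * by move=> w Nw /=; rewrite (W'E (t i))// (W'E (t i.+1)).
- move=> w; have [Nw|Nw] := pselect (N w).
    have -> : W' ^~ w = @Num.sqrt R by apply/funext => t; rewrite /W' mem_set.
    exact: tame_sqrt.
  have -> : W' ^~ w = fun t : R => W (Num.max 0 t) w.
    by apply/funext => t; rewrite /W' memNset.
  by apply: contrapT => ?; apply: Nw; exact: HN.
- exists N; split => // w /= H; apply: contrapT => Nw; apply: H => t t0.
  exact: W'E.
Qed.

End tame_modification.

(** * Exit times *)

Lemma near_dist (R : realType) (x : R) (Q : R -> Prop) :
  (\forall z \near x, Q z) ->
  exists2 e, 0 < e & forall z, `|x - z| < e -> Q z.
Proof. by move=> /(nbhs_ballP x Q).1[e /= e0 He]; exists e. Qed.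

Section exit_time.
Context {R : realType}.
Variables (g : R -> R) (hg : tame_path g).
Implicit Types y h t e : R.

(** The inequality is strict: being outside the closed interval is an open condition, which dyadic
    times detect. The set is nonempty for a tame path. *)
Definition exit_time y h : R := inf [set t : R | 0 <= t /\ h < `|y + g t|].

Let gc : continuous g. Proof. by case: hg. Qed.

Let exit_nonempty y h : [set t : R | 0 <= t /\ h < `|y + g t|] !=set0.
Proof.
have [_ _ + _] := hg => /(_ (Num.truncn (`|y| + `|h|)).+1)[t t0 H].
exists t; split => //.
have H1 : `|y| + `|h| < `|g t|.
  by apply: lt_trans H; exact: truncnS_gt.
have := ler_normB (y + g t) y; rewrite addrAC subrr add0r => H2.
have := ler_norm h; lra.
Qed.

Let exit_has_lbound y h : has_lbound [set t : R | 0 <= t /\ h < `|y + g t|].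
Proof. by exists 0 => t []. Qed.

Lemma exit_time_ge0 y h : 0 <= exit_time y h.
Proof. by apply: lb_le_inf => // t []. Qed.

Lemma exit_time_le y h t : 0 <= t -> h < `|y + g t| -> exit_time y h <= t.
Proof. by move=> t0 ht; apply: ge_inf. Qed.

Lemma before_exit_time y h t : 0 <= t -> t < exit_time y h -> `|y + g t| <= h.
Proof.
by move=> t0; apply: contraTT; rewrite -ltNge -leNgt; exact: exit_time_le.
Qed.

Lemma after_exit_time y h e : 0 < e ->
  exists t, [/\ exit_time y h <= t, t < exit_time y h + e & h < `|y + g t|].
Proof.
move=> e0.
have := inf_adherent e0 (conj (exit_nonempty y h) (exit_has_lbound y h)).
by move=> [t [t0 ht] te]; exists t; split => //; exact: exit_time_le.
Qed.

Lemma exit_time_mono y h h' : h <= h' -> exit_time y h <= exit_time y h'.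
Proof.
move=> hh'; apply: lb_le_inf => // t [t0 ht].
by apply: exit_time_le => //; exact: le_lt_trans ht.
Qed.

Let path_continuous y : continuous (fun t => `|y + g t|).
Proof.
move=> t; apply: cvg_norm; apply: cvgD; [exact: cvg_cst|exact: gc].
Qed.

(** A modulus above [h] at the exit time would be above [h] slightly earlier already (or at time 0,
    against [yh]); a modulus below [h] would stay below for a while, and the infimum would be
    larger. *)
Lemma exit_position y h : `|y| <= h -> `|y + g (exit_time y h)| = h.
Proof.
move=> yh; set s := exit_time y h.
have g0 : g 0 = 0 by case: hg.
apply/eqP; rewrite eq_le; apply/andP; split; rewrite leNgt; apply/negP => H.
  have s_gt0 : 0 < s.
    rewrite lt_neqAle exit_time_ge0 andbT eq_sym; apply/eqP => s0.
    by move: H; rewrite s0 g0 addr0 ltNge yh.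
  have [e e0 He] := near_dist (cvgr_gt _ (@path_continuous y s) _ H).
  pose t := s - Num.min (e / 2) s.
  have m0 : 0 < Num.min (e / 2) s by rewrite lt_min s_gt0 divr_gt0.
  have me : Num.min (e / 2) s <= e / 2 by rewrite ge_min lexx.
  have ms : Num.min (e / 2) s <= s by rewrite ge_min lexx orbT.
  have : h < `|y + g t|.
    apply: He; rewrite /t opprB addrCA subrr addr0 ger0_norm ?ltW//.
    by apply: (le_lt_trans me); lra.
  apply/negP; rewrite -leNgt; apply: before_exit_time; rewrite /t ?subr_ge0//.
  by rewrite -/s ltrBlDr ltrDl.
have [e e0 He] := near_dist (cvgr_lt _ (@path_continuous y s) _ H).
have [t [st te ht]] := after_exit_time y h e0.
suff : `|y + g t| < h by rewrite ltNge ltW.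
apply: He; rewrite distrC ger0_norm ?subr_ge0//.
by rewrite ltrBlDl.
Qed.

Lemma dyadic_after_exit y h e : 0 < e ->
  exists N, forall n, (N <= n)%N ->
    exists i, [/\ exit_time y h <= dyadic n i, dyadic n i < exit_time y h + e
      & h < `|y + g (dyadic n i)|].
Proof.
move=> e0; have [t [st te ht]] := after_exit_time y h e0.
have [e1 e10 He] := near_dist (cvgr_gt _ (@path_continuous y t) _ ht).
have t0 : 0 <= t := le_trans (exit_time_ge0 y h) st.
pose b := Num.min (t + e1) (exit_time y h + e).
have tb : t < b by rewrite lt_min te andbT ltrDl.
have [N HN] := dyadic_between t0 tb; exists N => n /HN[i /andP[ti]].
rewrite lt_min => /andP[i1 i2]; exists i; split => //.
  exact: le_trans st (ltW ti).
apply: He; rewrite distrC ger0_norm ?subr_ge0 ?ltW//.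
by rewrite ltrBlDl.
Qed.

End exit_time.

Section exit_measurable.
Context {R : realType} {d : measure_display} {Omega : measurableType d}.
Variables (W : R -> Omega -> R).
Hypothesis mW : forall t : R, 0 <= t -> measurable_fun setT (W t).
Hypothesis tW : forall w, tame_path (W ^~ w).
Variables (y h : R).
Let sigma w := exit_time (W ^~ w) y h.

Lemma measurable_exit_time : measurable_fun setT sigma.
Proof.
move=> mD; apply: (measurability _ (RGenInftyO.measurableE R)) => //.
move=> _ [_ [c ->] <-]; rewrite setTI.
have -> : sigma @^-1` `]-oo, c[ =
    \bigcup_n \bigcup_(i in [set i | dyadic n i < c])
      ((fun w => `|y + W (dyadic n i) w|) @^-1` `]h, +oo[).
  apply/seteqP; split => w /=.
    rewrite in_itv/= => sc.
    have sc0 : 0 < c - sigma w by rewrite subr_gt0.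
    have [N /(_ N (leqnn N)) [i [_ ic hi]]] := dyadic_after_exit (tW w) y h sc0.
    exists N => //; exists i => /=; last by rewrite in_itv/= hi.
    by move: ic; rewrite -/(sigma w) addrC subrK.
  move=> [n _ [i /= ic]]; rewrite !in_itv/= andbT => hi.
  apply: le_lt_trans ic; apply: exit_time_le => //; exact: dyadic_ge0.
apply: bigcup_measurable => n _; apply: bigcup_measurable => i _.
rewrite -[X in measurable X]setTI.
have : measurable_fun setT (fun w => `|y + W (dyadic n i) w|).
  apply: measurableT_comp => //; apply: measurable_funD => //.
  by apply: mW; exact: dyadic_ge0.
exact.
Qed.

(** Convergence is from above. When the grid stops, the path is outside or the horizon is reached,
    so it never stops before the minimum; and fine grids contain times just after [sigma w] at which
    the path is outside. *)
Lemma stop_index_exit_time w (T : nat) :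
  (stop_index (fun=> [set z | h < `|z|]) (grid_walk W (2 ^+ n)^-1 y)
     (T * 2 ^ n) w)%:R * (2 ^+ n)^-1 @[n --> \oo]
  --> Num.min (sigma w) T%:R.
Proof.
have W0 : W 0 w = 0 by case: (tW w).
pose A : nat -> set R := fun=> [set z : R | h < `|z|]; rewrite -/A.
set k := fun n => stop_index A (grid_walk W (2 ^+ n)^-1 y) (T * 2 ^ n) w.
have walkE n i : grid_walk W (2 ^+ n)^-1 y i w = y + W (dyadic n i) w.
  by rewrite /grid_walk W0 subr0.
have dT n : dyadic n (T * 2 ^ n) = T%:R :> R.
  by rewrite /dyadic natrM natrX mulfK// expf_neq0.
have dle n i j : (i <= j)%N -> dyadic n i <= dyadic n j :> R.
  by move=> ij; rewrite /dyadic ler_wpM2r ?ler_nat// invr_ge0 exprn_ge0.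
have kT n : dyadic n (k n) <= T%:R :> R.
  by rewrite -[leRHS](dT n); apply: dle; exact: stop_index_le.
have lo n : Num.min (sigma w) T%:R <= dyadic n (k n).
  have := stop_index_le A (grid_walk W (2 ^+ n)^-1 y) (T * 2 ^ n) w.
  rewrite leq_eqVlt => /predU1P[kE|lt].
    by rewrite /k kE dT ge_min lexx orbT.
  have := stop_index_lt lt; rewrite {1}/A /= -/(k n) walkE => hk.
  rewrite ge_min; apply/orP; left; apply: exit_time_le => //.
  exact: dyadic_ge0.
apply/cvgrPdist_le => e e0.
have [N HN] := dyadic_after_exit (tW w) y h e0.
near=> n.
have {HN}[|i [si ie hi]] := HN n; first by near: n; exact: nbhs_infty_ge.
rewrite distrC ger0_norm ?subr_ge0; last exact: lo.
rewrite lerBlDl -/(dyadic n (k n)).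
have [iT|Ti] := lerP (dyadic n i : R) (T%:R : R); last first.
  have [sT|Ts] := lerP (sigma w) T%:R; last by rewrite (le_trans (kT n))// lerDl ltW.
  apply: (le_trans (kT n)); apply: (le_trans (ltW Ti)); exact/ltW.
have ki : (k n <= i)%N.
  rewrite leqNgt; apply/negP => ik.
  by apply: (stop_index_before ik); rewrite /A /= walkE.
have kd := dle n _ _ ki.
have [sT|Ts] := lerP (sigma w) T%:R.
  apply: (le_trans kd); exact/ltW.
by rewrite (le_trans (kT n))// lerDl ltW.
Unshelve. all: by end_near.
Qed.

End exit_measurable.

(** * Limits of expectations *)

Section limit_expectation.
Context {R : realType} {d : measure_display} {Omega : measurableType d}.
Variable P : probability Omega R.

Lemma bounded_convergence (f_ : nat -> Omega -> R) (f : Omega -> R) (c : R) :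
  (forall n, measurable_fun setT (f_ n)) ->
  (forall n w, `|f_ n w| <= c) ->
  (forall w, f_ n w @[n --> \oo] --> f w) ->
  measurable_fun setT f /\
  (\int[P]_w (f_ n w)%:E @[n --> \oo] --> \int[P]_w (f w)%:E)%E.
Proof.
move=> mf_ bf cf.
have mf : measurable_fun setT f.
  by apply: (@measurable_fun_cvg _ _ _ _ f_) => // w _; exact: cf.
split=> //.
apply: (@dominated_cvg _ _ _ P setT measurableT (fun n w => (f_ n w)%:E)
  (fun w => (f w)%:E) (cst c%:E)) => //.
- by move=> n; exact/measurable_EFinP.
- by move=> w _; apply: cvg_EFin; [exact: nearW|exact: cf].
- exact: finite_measure_integrable_cst.
- by move=> n w _; rewrite lee_fin.
Qed.

(* The bound in L^2 makes the sequence uniformly integrable. *)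
Lemma square_bounded_convergence (f_ : nat -> Omega -> R) (f : Omega -> R)
    (a c C : R) :
  (forall n, measurable_fun setT (f_ n)) -> (forall n w, 0 <= f_ n w) ->
  (forall w, f_ n w @[n --> \oo] --> f w) ->
  (forall w, 0 <= f w <= c) ->
  (forall n, \int[P]_w (f_ n w)%:E = a%:E)%E ->
  (forall n, \int[P]_w (f_ n w ^+ 2)%:E <= C%:E)%E ->
  measurable_fun setT f /\ (\int[P]_w (f w)%:E = a%:E)%E.
Proof.
move=> mf_ f0 cf fc Ea EC.
have trunc b : c <= b -> 0 < b -> measurable_fun setT f /\
  (\int[P]_w (Num.min (f_ n w) b)%:E @[n --> \oo] --> \int[P]_w (f w)%:E)%E.
  move=> cb b0; apply: (@bounded_convergence _ _ b).
  - by move=> n; apply: measurable_minr.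
  - move=> n w; rewrite ger0_norm; first by rewrite ge_min lexx orbT.
    by rewrite le_min f0 ltW.
  - move=> w; have -> : f w = Num.min (f w) b.
      by rewrite min_l//; case/andP: (fc w) => _ /le_trans; exact.
    apply: (cvg_comp (f_ ^~ w) (fun x : R => Num.min x b) (cf w)).
    by apply: (@continuous_min R R id (cst b)); [exact: cvg_id|exact: cst_continuous].
have c1 : c <= `|c| + 1 by have := ler_norm c; lra.
have c10 : 0 < `|c| + 1 by have := normr_ge0 c; lra.
have [mf _] := trunc _ c1 c10; split => //.
have mm n b : measurable_fun setT (fun w => (Num.min (f_ n w) b)%:E).
  by apply/measurable_EFinP; exact: measurable_minr.
apply/eqP; rewrite eq_le; apply/andP; split.
  have [_ cv] := trunc _ c1 c10.
  rewrite -(cvg_lim _ cv)//; apply: lime_le; first exact: cvgP cv.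
  apply: nearW => n; rewrite -(Ea n); apply: ge0_le_integral => //=.
  - by move=> w _; rewrite lee_fin le_min f0 ltW.
  - exact/measurable_EFinP.
  - by move=> w _; rewrite lee_fin ge_min lexx.
apply/lee_addgt0Pr => e e0.
(* Truncation at [b] leaves [f] unchanged since b >= c, and C / b <= e controls the part cut off. *)
pose b := Num.max (`|c| + 1) (`|C| / e).
have b0 : 0 < b by rewrite lt_max c10.
have cb : c <= b by rewrite le_max c1.
have [_ cv] := trunc _ cb b0.
rewrite -leeBlDr// -(cvg_lim _ cv)//; apply: lime_ge; first exact: cvgP cv.
apply: nearW => n; rewrite leeBlDr// -(Ea n).
have Cb : C / b <= e.
  rewrite ler_pdivrMr//; apply: (@le_trans _ _ (e * (`|C| / e))).
    by rewrite mulrC divfK ?gt_eqF// ler_norm.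
  by apply: ler_wpM2l; [exact: ltW|rewrite le_max lexx orbT].
(* Pointwise, z <= min(z, b) + z^2 / b for z >= 0. *)
apply: (@le_trans _ _ (\int[P]_w ((Num.min (f_ n w) b)%:E +
    (b^-1)%:E * (f_ n w ^+ 2)%:E))%E).
  apply: ge0_le_integral => //=.
  - by move=> w _; rewrite lee_fin.
  - exact/measurable_EFinP.
  - apply: emeasurable_funD => //; apply: measurable_funeM.
    by apply/measurable_EFinP; exact: measurable_funX.
  - move=> w _; rewrite -EFinM -EFinD lee_fin.
    have [fb|bf] := lerP (f_ n w) b.
      by rewrite lerDl mulr_ge0 ?sqr_ge0// invr_ge0 ltW.
    apply: (@le_trans _ _ (b^-1 * f_ n w ^+ 2)); last by rewrite lerDr ltW.
    rewrite expr2 mulrA ler_peMl// mulrC ler_pdivlMr// mul1r ltW//.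
rewrite ge0_integralD//=; last 3 first.
- by move=> w _; rewrite lee_fin le_min f0 ltW.
- by move=> w _; rewrite -EFinM lee_fin mulr_ge0 ?sqr_ge0// invr_ge0 ltW.
- by apply: measurable_funeM; apply/measurable_EFinP; exact: measurable_funX.
apply: leeD => //; rewrite ge0_integralZl//=; last 3 first.
- by apply/measurable_EFinP; exact: measurable_funX.
- by move=> w _; rewrite lee_fin sqr_ge0.
- by rewrite lee_fin invr_ge0 ltW.
apply: (@le_trans _ _ ((b^-1)%:E * C%:E)%E).
  by apply: lee_wpmul2l => //; rewrite lee_fin invr_ge0 ltW.
by rewrite -EFinM lee_fin mulrC.
Qed.

End limit_expectation.

(** * Optional stopping at the exit time *)

Section optional_stopping.
Context {R : realType} {d : measure_display} {Omega : measurableType d}.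
Variables (P : probability Omega R) (W : R -> Omega -> R).
Hypothesis hW : brownian_motion P W.
Hypothesis tW : forall w, tame_path (W ^~ w).
Variables (y h theta : R).
Hypothesis yh : `|y| <= h.
Let sigma w := exit_time (W ^~ w) y h.

Let Mt t w := expR (theta * (y + W t w) - theta ^+ 2 * t / 2).

Let Mt_continuous w : continuous (Mt ^~ w).
Proof.
have [_ cW _ _] := tW w.
move=> t; apply: continuous_comp; last exact: continuous_expR.
apply: cvgB.
  by apply: cvgM; [exact: cvg_cst|apply: cvgD; [exact: cvg_cst|exact: cW]].
apply: cvgM; last exact: cvg_cst.
by apply: cvgM; [exact: cvg_cst|exact: cvg_id].
Qed.

Let inside w t : 0 <= t -> t <= sigma w -> `|y + W t w| <= h.
Proof.
move=> t0; rewrite le_eqVlt => /predU1P[->|]; last exact: before_exit_time.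
by have -> : `|y + W (sigma w) w| = h := exit_position (tW w) yh.
Qed.

Let Mt_bound w t : 0 <= t -> t <= sigma w ->
  Mt t w <= expR (`|theta| * h - theta ^+ 2 * t / 2).
Proof.
move=> t0 /(inside t0) H; rewrite ler_expR lerD2r.
by rewrite (le_trans (ler_norm _))// normrM ler_wpM2l.
Qed.

(** A grid overshoots the interval, so its stopped martingale is not bounded. Its second moment is:
    the square of the martingale at theta is exp(theta^2 t) times the one at 2 theta, where t <= T,
    and the latter has constant mean. *)
Let truncated (T : nat) :
  measurable_fun setT (fun w => Mt (Num.min (sigma w) T%:R) w) /\
  (\int[P]_w (Mt (Num.min (sigma w) T%:R) w)%:E = (expR (theta * y))%:E)%E.
Proof.
pose A : nat -> set R := fun=> [set z : R | h < `|z|].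
have mA i : measurable (A i).
  have -> : A i = (fun z : R => `|z|) @^-1` `]h, +oo[.
    by apply/seteqP; split => z /=; rewrite in_itv/= andbT.
  rewrite -[X in measurable X]setTI.
  by have : measurable_fun setT (fun z : R => `|z|) by []; exact.
have D0 n : 0 < (2 ^+ n : R)^-1 by rewrite invr_gt0 exprn_gt0.
pose U th n := stopped_martingale th (2 ^+ n)^-1 A
  (grid_walk W (2 ^+ n)^-1 y) (T * 2 ^ n).
pose t n w := (stop_index A (grid_walk W (2 ^+ n)^-1 y) (T * 2 ^ n) w)%:R *
  (2 ^+ n)^-1 : R.
have tT n w : t n w <= T%:R.
  rewrite /t ler_pdivrMr ?exprn_gt0// -natrX -natrM ler_nat.
  exact: stop_index_le.
have UE th n w : U th n w = expR (th * (y + W (t n w) w) - th ^+ 2 * t n w / 2).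
  have W0 : W 0 w = 0 by case: (tW w).
  by rewrite /U /stopped_martingale /exp_martingale /grid_walk W0 subr0.
apply: (@square_bounded_convergence _ _ _ P (U theta) _ _
    (expR (`|theta| * h)) (expR (theta ^+ 2 * T%:R) * expR (2 * theta * y))).
- by move=> n; exact: (measurable_brownian_stopped hW).
- by move=> n w; rewrite ltW// stopped_martingale_gt0.
- move=> w; rewrite (_ : U theta ^~ w = fun n => Mt (t n w) w); last first.
    by apply/funext => n; rewrite UE.
  apply: (cvg_comp (t ^~ w) (Mt ^~ w) _ (@Mt_continuous w _)).
  exact: stop_index_exit_time.
- move=> w; rewrite expR_ge0/=.
  have m0 : 0 <= Num.min (sigma w) T%:R by rewrite le_min exit_time_ge0//=.
  apply: (le_trans (Mt_bound m0 _)); first by rewrite ge_min lexx.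
  by rewrite ler_expR gerBl divr_ge0// mulr_ge0// sqr_ge0.
- by move=> n; exact: (brownian_stopped_martingale hW).
- move=> n; apply: (@le_trans _ _
      (\int[P]_w ((expR (theta ^+ 2 * T%:R))%:E * (U (2 * theta) n w)%:E))%E).
    apply: ge0_le_integral => //=.
    + by move=> w _; rewrite lee_fin; exact: sqr_ge0.
    + apply/measurable_EFinP; apply: measurable_funX.
      exact: (measurable_brownian_stopped hW).
    + apply: measurable_funeM; apply/measurable_EFinP.
      exact: (measurable_brownian_stopped hW).
    + move=> w _; rewrite -EFinM lee_fin !UE -expRM_natl -expRD ler_expR.
      have := ler_wpM2l (sqr_ge0 theta) (tT n w).
      rewrite -mulr_natl; set x := y + _; set tt := t n w.
      have -> : (2 * theta) ^+ 2 = 4 * theta ^+ 2 by ring.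
      lra.
  rewrite ge0_integralZl//=; last 2 first.
  + by apply/measurable_EFinP; exact: (measurable_brownian_stopped hW).
  + by move=> w _; rewrite lee_fin ltW// stopped_martingale_gt0.
  by rewrite (brownian_stopped_martingale hW).
Qed.

(** Up to the exit the path stays in [-h, h], so the martingale truncated at [T] is at most
    exp(|theta| h). As exit times are finite, it is eventually constant in [T] on each path, and
    bounded convergence applies. *)
Theorem exit_exp_martingale :
  measurable_fun setT
    (fun w => expR (theta * (y + W (sigma w) w) - theta ^+ 2 * sigma w / 2)) /\
  (\int[P]_w (expR (theta * (y + W (sigma w) w) -
     theta ^+ 2 * sigma w / 2))%:E = (expR (theta * y))%:E)%E.
Proof.
have [mM cM] : measurable_fun setT (fun w => Mt (sigma w) w) /\
    (\int[P]_w (Mt (Num.min (sigma w) T%:R) w)%:E @[T --> \oo] -->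
     \int[P]_w (Mt (sigma w) w)%:E)%E.
  apply: (@bounded_convergence _ _ _ P
    (fun (T : nat) w => Mt (Num.min (sigma w) T%:R) w) _ (expR (`|theta| * h))).
  - by move=> T; case: (truncated T).
  - move=> T w; rewrite ger0_norm ?expR_ge0//.
    have m0 : 0 <= Num.min (sigma w) T%:R by rewrite le_min exit_time_ge0//=.
    apply: (le_trans (Mt_bound m0 _)); first by rewrite ge_min lexx.
    by rewrite ler_expR gerBl divr_ge0// mulr_ge0// sqr_ge0.
  - move=> w; apply: cvg_near_cst; near=> T.
    rewrite min_l//; near: T; exact: nbhs_infty_ger.
split => //; have := cvg_lim _ cM => <-//.
under eq_fun do rewrite (truncated _).2.
exact: lim_cst.
Unshelve. all: by end_near.
Qed.

End optional_stopping.

(** * Hyperbolic functions *)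

Section hyperbolic.
Context {R : realType}.
Implicit Types a b x y q : R.

Definition cosh x : R := (expR x + expR (- x)) / 2.
Definition sinh x : R := (expR x - expR (- x)) / 2.

Lemma coshN x : cosh (- x) = cosh x.
Proof. by rewrite /cosh opprK addrC. Qed.

Lemma cosh_norm x : cosh `|x| = cosh x.
Proof. by have [_|_] := ger0P x; rewrite ?coshN. Qed.

Lemma sinhN x : sinh (- x) = - sinh x.
Proof. by rewrite /sinh opprK -mulNr opprB. Qed.

Lemma sinh0 : sinh 0 = 0.
Proof. by rewrite /sinh oppr0 subrr mul0r. Qed.

Lemma cosh0 : cosh 0 = 1.
Proof. by rewrite /cosh oppr0 expR0 -mulr2n -mulr_natr mul1r divff. Qed.

(** Convexity, from 1 + z <= exp z applied to each of the two exponentials. *)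
Lemma cosh_tangent a b : cosh b + (a - b) * sinh b <= cosh a.
Proof.
have h1 := expR_ge1Dx (a - b); have h2 := expR_ge1Dx (b - a).
have e1 : expR a = expR b * expR (a - b) by rewrite -expRD addrC subrK.
have e2 : expR (- a) = expR (- b) * expR (b - a).
  by rewrite -expRD addrA addNr add0r.
have p1 := expR_gt0 b; have p2 := expR_gt0 (- b).
have q1 := ler_wpM2l (ltW p1) h1; have q2 := ler_wpM2l (ltW p2) h2.
rewrite /cosh /sinh e1 e2; lra.
Qed.

Lemma cosh_tangent_lt a b : a != b -> cosh b + (a - b) * sinh b < cosh a.
Proof.
move=> ab; have h1 : 1 + (a - b) < expR (a - b).
  by apply: expR_gt1Dx; rewrite subr_eq0.
have h2 := expR_ge1Dx (b - a).
have e1 : expR a = expR b * expR (a - b) by rewrite -expRD addrC subrK.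
have e2 : expR (- a) = expR (- b) * expR (b - a).
  by rewrite -expRD addrA addNr add0r.
have p1 := expR_gt0 b; have p2 := expR_gt0 (- b).
have q2 := ler_wpM2l (ltW p2) h2.
have q1 : expR b * (1 + (a - b)) < expR b * expR (a - b) by rewrite ltr_pM2l.
rewrite /cosh /sinh e1 e2; lra.
Qed.

Lemma cosh_ge1 x : 1 <= cosh x.
Proof. by have := cosh_tangent x 0; rewrite cosh0 sinh0 mulr0 addr0. Qed.

Lemma cosh_gt0 x : 0 < cosh x.
Proof. by rewrite (lt_le_trans _ (cosh_ge1 x)). Qed.

Lemma sinh_ge0 x : 0 <= x -> 0 <= sinh x.
Proof.
by move=> x0; rewrite divr_ge0// subr_ge0 ler_expR; lra.
Qed.

Lemma sinh_gt0 x : 0 < x -> 0 < sinh x.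
Proof.
by move=> x0; rewrite divr_gt0// subr_gt0 ltr_expR; lra.
Qed.

Lemma ler_cosh a b : `|a| <= `|b| -> cosh a <= cosh b.
Proof.
rewrite -(cosh_norm a) -(cosh_norm b) => ab.
have := cosh_tangent `|b| `|a|; apply: le_trans.
by rewrite lerDl mulr_ge0 ?subr_ge0// sinh_ge0.
Qed.

Lemma sinhD a b : sinh (a + b) = sinh a * cosh b + cosh a * sinh b.
Proof. by rewrite /sinh /cosh opprD !expRD; field. Qed.

Lemma coshD a b : cosh (a + b) = cosh a * cosh b + sinh a * sinh b.
Proof. by rewrite /sinh /cosh opprD !expRD; field. Qed.

(** A crude mean value bound. The factor 2 is slack: the bound only serves to control error
    terms. *)
Lemma sinh_sub_le a b : 0 <= a -> a <= b -> sinh b - sinh a <= 2 * (b - a) * cosh b.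
Proof.
move=> a0 ab; have h1 := expR_ge1Dx (a - b).
have h2 := expR_ge1Dx (a - b).
have e1 : expR a = expR b * expR (a - b) by rewrite -expRD addrC subrK.
have e2 : expR (- b) = expR (- a) * expR (a - b).
  by rewrite -expRD addrA addNr add0r.
have p1 := expR_gt0 b; have p2 := expR_gt0 (- a); have p3 := expR_gt0 (- b).
have p4 : expR (- a) <= 1 by rewrite -[leRHS]expR0 ler_expR; lra.
have p5 : 1 <= expR b by rewrite -[leLHS]expR0 ler_expR; lra.
have q1 := ler_wpM2l (ltW p1) h1; have q2 := ler_wpM2l (ltW p2) h1.
have q3 : (b - a) * expR (- a) <= (b - a) * expR b.
  by apply: ler_wpM2l; [rewrite subr_ge0|exact: le_trans p5].
have q4 : 0 <= (b - a) * expR (- b) by rewrite mulr_ge0 ?subr_ge0// ltW.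
rewrite /cosh /sinh e1; rewrite {1}e2; lra.
Qed.

(** The difference vanishes at 0 and has derivative a (cosh x - cosh (a x)) >= 0. *)
Lemma sinh_ratio a q : 0 <= a <= 1 -> 0 <= q -> sinh (a * q) <= a * sinh q.
Proof.
move=> /andP[a0 a1] q0; rewrite -subr_ge0.
pose k (x : R) := a * sinh x - sinh (a * x).
have dk (x : R) : is_derive x 1 k (a * cosh x - a * cosh (a * x)).
  rewrite /k /sinh; apply: is_derive_eq.
  by rewrite /GRing.scale /= /cosh; field.
have k0 : k 0 = 0 by rewrite /k mulr0 sinh0 mulr0 subr0.
rewrite -/(k q) -k0.
apply: (@ger0_derive1_le _ k 0 q _ _ true false) => //.
- move=> x; rewrite in_itv/= => /andP[x0 _].
  have ? := dk x; rewrite derive1E derive_val -mulrBr mulr_ge0// subr_ge0.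
  apply: ler_cosh; rewrite !ger0_norm ?mulr_ge0//; try exact: ltW.
  by rewrite ler_piMl// ltW.
- apply: derivable_within_continuous => x _; have ? := dk x; exact: ex_derive.
- by rewrite in_itv/= lexx q0.
- by rewrite in_itv/= lexx q0.
Qed.

End hyperbolic.

(** * Laplace transform of the exit time *)

Section bounded.
Context {R : realType} {d : measure_display} {T : measurableType d}.
Variable P : probability T R.

Lemma integrable_bounded (f : T -> R) (c : R) :
  measurable_fun setT f -> (forall x, `|f x| <= c) ->
  P.-integrable setT (EFin \o f).
Proof.
move=> mf fc.
apply: (le_integrable measurableT _ _ (finite_measure_integrable_cst P c measurableT)).
- exact/measurable_EFinP.
- by move=> x _ /=; rewrite lee_fin (le_trans (fc x))// ler_norm.
Qed.

Lemma probability_markov (f : T -> R) (e a : R) : 0 < e ->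
  measurable_fun setT f -> (forall x, 0 <= f x) ->
  (\int[P]_x (f x)%:E = a%:E)%E -> (P [set x | (e <= f x)%R] <= (a / e)%:E)%E.
Proof.
move=> e0 mf f0 Ea.
have mE : measurable [set x | e <= f x].
  have -> : [set x | e <= f x] = f @^-1` `[e, +oo[.
    by apply/seteqP; split => x /=; rewrite in_itv/= andbT.
  by rewrite -[X in measurable X]setTI; exact: mf.
rewrite mulrC EFinM lee_pdivlMl// -integral_cst// -Ea.
apply: (@le_trans _ _ (\int[P]_(x in [set x | (e <= f x)%R]) (f x)%:E)%E).
  apply: ge0_le_integral => //=.
  - by move=> x _; rewrite lee_fin ltW.
  - by apply: measurable_funTS; exact/measurable_EFinP.
apply: ge0_subset_integral => //=; first exact/measurable_EFinP.
by move=> x _; rewrite lee_fin.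
Qed.

End bounded.

Section exit_laplace.
Context {R : realType} {d : measure_display} {Omega : measurableType d}.
Variables (P : probability Omega R) (W : R -> Omega -> R).
Hypothesis hW : brownian_motion P W.
Hypothesis tW : forall w, tame_path (W ^~ w).
Local Notation sigma y h w := (exit_time (W ^~ w) y h).

Let mW := bm_measurable hW.

Lemma measurable_exit_discount (y h : R) (c : R) :
  measurable_fun setT (fun w => expR (- (c * sigma y h w))).
Proof.
apply: measurableT_comp => //; apply: measurableT_comp => //.
by apply: measurable_funM => //; exact: measurable_exit_time.
Qed.

Section interval.
Variables (y h : R).
Hypothesis yh : `|y| <= h.
Let Z w := y + W (sigma y h w) w.
Let Zh w : `|Z w| = h := exit_position (tW w) yh.
Let F (theta : R) w := expR (theta * Z w - theta ^+ 2 * sigma y h w / 2).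
Let D (theta : R) w := expR (- (theta ^+ 2 / 2 * sigma y h w)).

Let FE theta w : F theta w = expR (theta * Z w) * D theta w.
Proof. by rewrite /F /D -expRD; congr expR; ring. Qed.

Let D_le1 theta w : 0 <= D theta w <= 1.
Proof.
rewrite expR_ge0/= -[leRHS]expR0 ler_expR oppr_le0 mulr_ge0//.
  by rewrite divr_ge0// sqr_ge0.
exact: exit_time_ge0.
Qed.

Let F_integrable theta : P.-integrable setT (EFin \o F theta).
Proof.
apply: (@integrable_bounded _ _ _ P _ (expR (`|theta| * h))).
  by case: (exit_exp_martingale hW tW theta yh).
move=> w; rewrite ger0_norm ?expR_ge0// FE.
rewrite -[leRHS]mulr1; have /andP[D0 D1] := D_le1 theta w.
apply: ler_pM => //.
by rewrite ler_expR (le_trans (ler_norm _))// normrM Zh.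
Qed.

Let F_expectation theta : \int[P]_w F theta w = expR (theta * y).
Proof. by rewrite /Rintegral (exit_exp_martingale hW tW theta yh).2. Qed.

(** The exit position is h or -h, so adding the martingales at theta and -theta makes the factor
    containing it the constant 2 cosh(theta h). *)
Lemma exit_laplace theta :
  \int[P]_w expR (- (theta ^+ 2 / 2 * sigma y h w)) = cosh (theta * y) / cosh (theta * h).
Proof.
have c0 := gt_eqF (cosh_gt0 (theta * h)).
transitivity (\int[P]_w ((2 * cosh (theta * h))^-1 * (F theta w + F (- theta) w))).
  apply: eq_Rintegral => w _; rewrite !FE /D sqrrN -mulrDl mulNr.
  have -> : expR (theta * Z w) + expR (- (theta * Z w)) = 2 * cosh (theta * h).
    rewrite -[cosh (theta * h)]cosh_norm normrM.
    have -> : `|h| = `|Z w| by rewrite Zh ger0_norm// -(Zh w).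
    by rewrite -normrM cosh_norm /cosh [RHS]mulrC divfK.
  by rewrite mulKf// mulf_neq0 ?c0.
rewrite RintegralZl//; last first.
  exact: (integrableD measurableT (F_integrable theta) (F_integrable (- theta))).
rewrite RintegralD// !F_expectation mulNr /cosh; set a := expR _ + expR _.
by rewrite invfM mulrC mulrA.
Qed.

(** The difference of the two martingales contains sinh(theta Z), which is Z sinh(theta h) / h
    because Z is h or -h. *)
Lemma exit_laplace_position theta : 0 < theta -> 0 < h ->
  \int[P]_w (expR (- (theta ^+ 2 / 2 * sigma y h w)) * Z w) =
  h * sinh (theta * y) / sinh (theta * h).
Proof.
move=> th0 h0; have s0 := sinh_gt0 (mulr_gt0 th0 h0).
transitivity (\int[P]_w (h * (2 * sinh (theta * h))^-1 * (F theta w - F (- theta) w))).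
  apply: eq_Rintegral => w _; rewrite !FE /D sqrrN -mulrBl mulNr.
  have -> : expR (theta * Z w) - expR (- (theta * Z w)) = 2 * sinh (theta * Z w).
    by rewrite /sinh [RHS]mulrC divfK.
  have : Z w = h \/ Z w = - h.
    have [Z0|Z0] := lerP 0 (Z w).
      by left; rewrite -(Zh w) ger0_norm.
    by right; rewrite -(Zh w) ltr0_norm// opprK.
  by case=> ->; rewrite ?mulrN ?sinhN; field; rewrite gt_eqF.
rewrite RintegralZl//; last first.
  exact: (integrableB measurableT (F_integrable theta) (F_integrable (- theta))).
rewrite RintegralB// !F_expectation mulNr.
have -> : expR (theta * y) - expR (- (theta * y)) = 2 * sinh (theta * y).
  by rewrite /sinh [RHS]mulrC divfK.
by field; rewrite gt_eqF.
Qed.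

End interval.

(* The exit times from the levels hk k < h have Laplace transforms converging to
   that of the exit time from h, so their supremum is almost surely the latter. *)
Lemma exit_regular (y h : R) : `|y| < h ->
  {ae P, forall w, forall t : R, 0 <= t -> t < sigma y h w -> `|y + W t w| < h}.
Proof.
move=> yh.
(* These levels start at |y| for k = 0 and increase to [h]. *)
pose hk (k : nat) := h - (h - `|y|) / k.+1%:R.
have yh0 : 0 < h - `|y| by rewrite subr_gt0.
have hk_lt k : hk k < h by rewrite gtrBl divr_gt0.
have hk_ge k : `|y| <= hk k.
  rewrite lerBrDl -lerBrDr ler_pdivrMr//.
  by apply: ler_peMr; [exact: ltW|rewrite ler1n].
(* A nonnegative gap between discounts at theta = 1, whose mean is O(1 / k) by the tangent bound for
   [cosh]. *)
pose D k w := expR (- (1 ^+ 2 / 2 * sigma y (hk k) w)) - expR (- (1 ^+ 2 / 2 * sigma y h w)).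
have mD k : measurable_fun setT (D k).
  by apply: measurable_funB; exact: measurable_exit_discount.
have D0 k w : 0 <= D k w.
  rewrite subr_ge0 ler_expR lerN2 ler_wpM2l//.
  by apply: (exit_time_mono (tW w)); exact: ltW.
have int_disc (h' : R) : P.-integrable setT
    (EFin \o (fun w => expR (- (1 ^+ 2 / 2 * sigma y h' w)))).
  apply: (@integrable_bounded _ _ _ P _ 1); first exact: measurable_exit_discount.
  move=> w; rewrite ger0_norm ?expR_ge0// -[leRHS]expR0 ler_expR oppr_le0.
  by rewrite mulr_ge0// exit_time_ge0.
have ED k : (\int[P]_w (D k w)%:E = (cosh y / cosh (hk k) - cosh y / cosh h)%:E)%E.
  rewrite -(fineK (x := (\int[P]_w (D k w)%:E)%E)); last first.
    apply: integrable_fin_num => //.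
    exact: (integrableB measurableT (int_disc _) (int_disc _)).
  rewrite -[fine _]/(\int[P]_w (D k w)) RintegralB//.
  by rewrite !exit_laplace ?mul1r// ltW.
have ED_le k : cosh y / cosh (hk k) - cosh y / cosh h <= sinh h * (h - `|y|) / k.+1%:R.
  have c1 := cosh_gt0 (hk k); have c2 := cosh_gt0 h.
  have -> : cosh y / cosh (hk k) - cosh y / cosh h =
      cosh y / cosh (hk k) * ((cosh h - cosh (hk k)) / cosh h).
    by field; rewrite !gt_eqF.
  have h0 : 0 <= hk k by exact: le_trans (hk_ge k).
  have r1 : cosh y / cosh (hk k) <= 1.
    by rewrite ler_pdivrMr// mul1r ler_cosh// (ger0_norm h0).
  have r2 : 0 <= cosh h - cosh (hk k).
    rewrite subr_ge0 ler_cosh// !ger0_norm//; first exact: ltW.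
    by rewrite (le_trans h0)// ltW.
  have r3 : cosh h - cosh (hk k) <= sinh h * (h - `|y|) / k.+1%:R.
    have E : hk k - h = - ((h - `|y|) / k.+1%:R) by rewrite /hk addrAC subrr add0r.
    have := cosh_tangent (hk k) h; rewrite E -mulrA.
    by move: (_ / _) (cosh h) (sinh h) (cosh (hk k)) => q u v z; lra.
  apply: le_trans r3.
  apply: (@le_trans _ _ (1 * (cosh h - cosh (hk k)))); last by rewrite mul1r.
  apply: ler_pM => //; first by rewrite divr_ge0 ?ltW ?cosh_gt0.
  - by rewrite divr_ge0// ltW.
  - by rewrite ler_pdivrMr// ler_peMr// cosh_ge1.
have bad0 (m : nat) : {ae P, forall w, exists k, D k w < m.+1%:R^-1}.
  have mbad k : measurable [set w | m.+1%:R^-1 <= D k w].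
    have -> : [set w | m.+1%:R^-1 <= D k w] = D k @^-1` `[m.+1%:R^-1, +oo[.
      by apply/seteqP; split => w /=; rewrite in_itv/= andbT.
    by rewrite -[X in measurable X]setTI; exact: mD.
  exists (\bigcap_k [set w | m.+1%:R^-1 <= D k w]); split.
  - exact: bigcap_measurable.
  - apply: probability_le_all0 => e e0.
    pose c := sinh h * (h - `|y|) * m.+1%:R.
    pose k := Num.truncn (c / e).
    apply: (@le_trans _ _ (P [set w | m.+1%:R^-1 <= D k w])).
      apply: le_measure; rewrite ?inE//; first exact: bigcap_measurable.
      by move=> w; apply.
    have m0 : 0 < m.+1%:R^-1 :> R by rewrite invr_gt0.
    apply: (le_trans (probability_markov m0 (mD k) (D0 k) (ED k))).
    rewrite lee_fin invrK.
    apply: (@le_trans _ _ (sinh h * (h - `|y|) / k.+1%:R * m.+1%:R)).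
      by rewrite ler_wpM2r.
    rewrite mulrAC -/c ler_pdivrMr// mulrC -ler_pdivrMr// ltW// truncnS_gt//.
  - move=> w /= /forallNP H k _ /=; rewrite leNgt; apply/negP; exact: H.
apply: filterS (ae_foralln bad0) => w Hw t t0 ts.
(* Either some lower level is not yet left at time [t], which settles the claim, or [t] bounds all
   the exit times from lower levels; then every [D k] is at least a fixed positive number, against
   [Hw]. *)
have [[k tk]|/forallNP Hk] := pselect (exists k, t < sigma y (hk k) w).
  by apply: le_lt_trans (hk_lt k); exact: (before_exit_time t0 tk).
exfalso.
pose e := expR (- (1 ^+ 2 / 2 * t)) - expR (- (1 ^+ 2 / 2 * sigma y h w)).
have e0 : 0 < e by rewrite subr_gt0 ltr_expR ltrN2 ltr_pM2l.
have [k Dk] := Hw (Num.truncn e^-1).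
have : e <= D k w.
  rewrite lerD2r ler_expR lerN2 ler_wpM2l// leNgt; apply/negP; exact: Hk.
apply/negP; rewrite -ltNge; apply: lt_le_trans Dk _.
by rewrite invf_ple ?posrE// ltW// truncnS_gt.
Qed.

End exit_laplace.

(** * Payoffs along a path *)

Section nonmeasurable_integrand.
Context {R : realType} {d : measure_display} {T : measurableType d}.
Variable mu : {measure set T -> \bar R}.

Import HBNNSimple.

(* The integrands need not be measurable: the library integral of a nonnegative
   function is a supremum over the simple functions below it, and cutting such
   a simple function to the complement of N does not change its integral. *)
Lemma ge0_le_integral_outside (N : set T) (f g : T -> \bar R) :
  measurable N -> mu N = 0%E ->
  (forall x, 0 <= f x)%E -> (forall x, 0 <= g x)%E ->
  (forall x, ~ N x -> f x <= g x)%E ->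
  (\int[mu]_x f x <= \int[mu]_x g x)%E.
Proof.
move=> mN N0 f0 g0 fg; rewrite !ge0_integralE//=.
apply: ge_ereal_sup => _ [h /= hf <-].
have mNC : measurable (~` N) by exact: measurableC.
pose h' := proj_nnsfun h mNC.
have -> : sintegral mu h = sintegral mu h'.
  rewrite -!integralT_nnsfun; apply: ae_eq_integral => //.
  - by apply/measurable_EFinP.
  - by apply/measurable_EFinP.
  exists N; split => // x /= H; apply: contrapT => Nx; apply: H => _.
  by rewrite /= mindicE mem_set// mulr1.
apply: ereal_sup_ubound; exists h' => //= x; rewrite patchT ?inE//.
rewrite /= mindicE; have [Nx|Nx] := pselect (N x).
  by rewrite memNset ?mulr0// => /(_ Nx).
rewrite mem_set// mulr1; have := hf x.
by rewrite patchT ?inE// => /le_trans; apply; exact: fg.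
Qed.

Lemma ge0_eq_integral_outside (N : set T) (f g : T -> \bar R) :
  measurable N -> mu N = 0%E ->
  (forall x, 0 <= f x)%E -> (forall x, 0 <= g x)%E ->
  (forall x, ~ N x -> f x = g x) ->
  (\int[mu]_x f x = \int[mu]_x g x)%E.
Proof.
move=> mN N0 f0 g0 fg; apply/eqP; rewrite eq_le.
by rewrite !(@ge0_le_integral_outside N)// => x /fg ->.
Qed.

End nonmeasurable_integrand.

Section payoff.
Context {R : realType} {d : measure_display} {Omega : measurableType d}.
Variables (beta : R) (beta0 : 0 < beta).

Definition discount (t : R) : R := 1 / (1 + beta * t).
Definition reflected (W : R -> Omega -> R) (x t : R) (w : Omega) : R :=
  `|x + W t w|.
Definition payoff (W : R -> Omega -> R) :=
  stopped_payoff (reflected W) (fun x : R => x) discount.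

Lemma discount_gt0 t : 0 <= t -> 0 < discount t.
Proof. by move=> t0; rewrite divr_gt0// ltr_pwDl// mulr_ge0// ltW. Qed.

Lemma discount_le1 t : 0 <= t -> discount t <= 1.
Proof.
move=> t0; have bt : 0 <= beta * t by rewrite mulr_ge0// ltW.
by rewrite ler_pdivrMr ?ltr_pwDl// mul1r lerDl.
Qed.

Lemma discounted_limsup_ge0 (g : R -> R) (x : R) :
  (0 <= limf_esup (fun t : R => (discount t * `|x + g t|)%:E) (+oo)%R)%E.
Proof.
rewrite limf_esupE; apply: le_ereal_inf_tmp => _ [V [M [_ HM]] <-].
pose t := Num.max (M + 1) 0.
have Mt : M < t by rewrite lt_max ltrDl ltr01.
have t0 : 0 <= t by rewrite le_max lexx orbT.
apply: (@le_trans _ _ (discount t * `|x + g t|)%:E).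
  by rewrite lee_fin mulr_ge0// ltW// discount_gt0.
by apply: ereal_sup_ubound; exists t => //; exact: HM.
Qed.

Lemma limf_esup_pinfty_le (f g : R -> \bar R) : (forall t : R, 0 <= t -> f t = g t) ->
  (limf_esup f (+oo)%R <= limf_esup g (+oo)%R)%E.
Proof.
move=> fg; rewrite !limf_esupE.
apply: le_ereal_inf_tmp => _ [V [M [_ HM]] <-].
apply: (@le_trans _ _ (ereal_sup [set f t | t in [set t : R | Num.max M 0 < t]])).
  apply: ereal_inf_lbound; exists [set t : R | Num.max M 0 < t] => //.
  by exists (Num.max M 0); split => //; exact: num_real.
apply: ge_ereal_sup => _ [t /= Ht <-]; move: Ht; rewrite gt_max => /andP[Mt t0].
rewrite fg; last exact: ltW.
by apply: ereal_sup_ubound; exists t => //; exact: HM.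
Qed.

Lemma discounted_tame_limsup (g : R -> R) (x : R) : tame_path g ->
  limf_esup (fun t : R => (discount t * `|x + g t|)%:E) (+oo)%R = 0%E.
Proof.
move=> [_ _ _ sub]; apply/eqP; rewrite eq_le; apply/andP; split; last first.
  exact: discounted_limsup_ge0.
apply/lee_addgt0Pr => e e0; rewrite add0e.
(* The slope e beta / 2 takes half of the growth of e (1 + beta t); the other half absorbs the
   constants. *)
have be0 : 0 < e * beta / 2 by rewrite divr_gt0// mulr_gt0.
have [C HC] := sub _ be0.
pose M := Num.max 0 ((`|x| + C) / (e * beta / 2)).
have M0 : 0 <= M by rewrite le_max lexx.
rewrite limf_esupE; apply: (@le_trans _ _
  (ereal_sup [set (discount t * `|x + g t|)%:E | t in [set t : R | M < t]])).
  apply: ereal_inf_lbound; exists [set t : R | M < t] => //.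
  by exists M; split => //; exact: num_real.
apply: ge_ereal_sup => _ [t /= Mt <-]; rewrite lee_fin.
have t0 : 0 <= t := le_trans M0 (ltW Mt).
have bt : 0 <= beta * t by rewrite mulr_ge0// ltW.
rewrite /discount mulrAC mul1r ler_pdivrMr ?ltr_pwDl//.
apply: (le_trans (ler_normD _ _)).
have := HC t t0.
have : (`|x| + C) < e * beta / 2 * t.
  rewrite mulrC -ltr_pdivrMr//; apply: le_lt_trans Mt.
  by rewrite le_max lexx orbT.
have -> : e * (1 + beta * t) = e + e * beta * t by ring.
lra.
Qed.

Lemma hitting_time_ge0 (W : R -> Omega -> R) x A w :
  (0 <= hitting_time (reflected W) x A w)%E.
Proof. by apply: le_ereal_inf_tmp => _ [t [t0 _] <-]; rewrite lee_fin ltW. Qed.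

Lemma payoff_ge0 (W : R -> Omega -> R) x A w : (0 <= payoff W x A w)%E.
Proof.
rewrite /payoff /stopped_payoff; have := hitting_time_ge0 W x A w.
case: (hitting_time _ _ _ _) => [t|_|//]; last exact: discounted_limsup_ge0.
rewrite lee_fin => t0; rewrite lee_fin; apply: mulr_ge0; last exact: normr_ge0.
by rewrite ltW// discount_gt0.
Qed.

Lemma eq_payoff (W W' : R -> Omega -> R) x A w :
  (forall t : R, 0 <= t -> W' t w = W t w) -> payoff W' x A w = payoff W x A w.
Proof.
move=> WW'.
have hE : hitting_time (reflected W') x A w = hitting_time (reflected W) x A w.
  rewrite /hitting_time; congr ereal_inf; apply/seteqP.
  by split => _ [t [t0 At] <-]; exists t => //; split => //; move: At;
    rewrite /reflected WW'// ltW.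
have rE t : 0 <= t -> reflected W' x t w = reflected W x t w.
  by move=> t0; rewrite /reflected WW'.
rewrite /payoff /stopped_payoff hE; have := hitting_time_ge0 W x A w.
case: (hitting_time _ _ _ _) => [t|_|//].
  by rewrite lee_fin => t0; rewrite rE.
by apply/eqP; rewrite eq_le !limf_esup_pinfty_le// => t t0; rewrite rE.
Qed.

Variable (W : R -> Omega -> R).
Hypothesis tW : forall w, tame_path (W ^~ w).

(** The hitting time is an infimum over positive times that may be 0 or not attained, so [PayoffAt]
    only promises visits to [A] at [t] or arbitrarily soon after. *)
Variant payoff_spec (x : R) (A : set R) (w : Omega) : Prop :=
| PayoffNever of payoff W x A w = 0%E
    & (forall t, 0 < t -> ~ A `|x + W t w|)
| PayoffAt t of 0 <= t & hitting_time (reflected W) x A w = t%:E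
    & payoff W x A w = (discount t * `|x + W t w|)%:E
    & (forall s, 0 < s -> s < t -> ~ A `|x + W s w|)
    & (forall e, 0 < e -> exists s, [/\ 0 < s, t <= s, s < t + e & A `|x + W s w|]).

Lemma payoffP x A w : payoff_spec x A w.
Proof.
set H := [set t%:E | t in [set t : R | 0 < t /\ A (reflected W x t w)]].
have inf0 : (0 <= ereal_inf H)%E := hitting_time_ge0 W x A w.
case E : (ereal_inf H) => [t||].
- have t0 : 0 <= t by move: inf0; rewrite E lee_fin.
  have before s : 0 < s -> s < t -> ~ A `|x + W s w|.
    move=> s0 st As; have : (ereal_inf H <= s%:E)%E.
      by apply: ereal_inf_lbound; exists s.
    by rewrite E lee_fin leNgt st.
  apply: (@PayoffAt _ _ _ t) => //.
    by rewrite /payoff /stopped_payoff /hitting_time -/H E.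
  move=> e e0; have : (ereal_inf H < (t + e)%:E)%E by rewrite E lte_fin ltrDl.
  move=> /ereal_inf_lt[_ [s [s0 As] <-]]; rewrite lte_fin => se.
  exists s; split => //; rewrite leNgt; apply/negP => st.
  exact: (before s).
- apply: PayoffNever.
    rewrite /payoff /stopped_payoff /hitting_time -/H E.
    exact: (discounted_tame_limsup x (tW w)).
  move=> t t0 At; have : (ereal_inf H <= t%:E)%E.
    by apply: ereal_inf_lbound; exists t.
  by rewrite E.
- by move: inf0; rewrite E.
Qed.

Let path_continuous (x : R) w : continuous (fun t : R => `|x + W t w|).
Proof.
have [_ cW _ _] := tW w.
move=> t; apply: cvg_norm; apply: cvgD; [exact: cvg_cst|exact: cW].
Qed.

Let path0 (x : R) w : 0 <= x -> `|x + W 0 w| = x.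
Proof. by have [-> _ _ _] := tW w; rewrite addr0 => x0; rewrite ger0_norm. Qed.

Let payoff_le t (c y : R) : 0 <= t -> 0 <= y -> y <= c -> ((discount t * y)%:E <= c%:E)%E.
Proof.
move=> t0 y0 yc; rewrite lee_fin; apply: le_trans yc.
by rewrite ler_piMl// discount_le1.
Qed.

(** The position at the hitting time may lie outside [A], but it is a limit of positions in [A],
    hence at most [l]. *)
Lemma payoff_le_below (x l : R) A w : 0 <= l -> A `<=` [set a | a <= l] ->
  (payoff W x A w <= l%:E)%E.
Proof.
move=> l0 Al; case: (payoffP x A w) => [->|t t0 _ -> _ after].
  by rewrite lee_fin.
apply: payoff_le => //; rewrite leNgt; apply/negP => H.
have [e e0 He] := near_dist (cvgr_gt _ (@path_continuous x w t) _ H).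
have [s [s0 ts se /Al /=]] := after e e0.
by apply/negP; rewrite -ltNge; apply: He; rewrite distrC ger0_norm ?subr_ge0// ltrBlDl.
Qed.

(** To be above [x] at the hitting time, the path would have to cross a point of [A] strictly above
    [x], and thus hit [A] strictly earlier. *)
Lemma payoff_le_dense (x r : R) A w : 0 <= r -> r <= x ->
  (forall u v, r <= u -> u < v -> exists2 a, A a & u < a < v) ->
  (payoff W x A w <= x%:E)%E.
Proof.
move=> r0 rx dense; have x0 := le_trans r0 rx.
case: (payoffP x A w) => [->|t t0 _ -> before _].
  by rewrite lee_fin.
apply: payoff_le => //; rewrite leNgt; apply/negP => H.
have [a Aa /andP[xa aX]] := dense _ _ rx H.
have [s sI sE] : exists2 s, s \in `[0, t] & `|x + W s w| = a.
  apply: (IVT t0 (continuous_subspaceT (@path_continuous x w))).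
  by rewrite path0// (min_l (ltW H)) (max_r (ltW H)) !ltW.
move: sI; rewrite in_itv/= => /andP[s0 st].
apply: (before s); last by rewrite sE.
- rewrite lt_neqAle s0 andbT eq_sym; apply/eqP => s0'.
  by move: xa; rewrite -sE s0' path0// ltxx.
- rewrite lt_neqAle st andbT; apply/eqP => st'.
  by move: aX; rewrite -sE st' ltxx.
Qed.

(** Before [s] the path is strictly inside the gap; right after [s] it gets beyond an end, and by
    the intermediate value theorem it crosses points of the target that accumulate there. Stating
    the hypotheses on the modulus lets [l] be negative, as in the symmetric gap (-r, r). *)
Lemma payoff_gap (x l r : R) A w : l < x -> x < r ->
  (forall y, l < y -> y < r -> ~ A `|y|) ->
  (forall e, 0 < e -> exists2 y, A `|y| & l - e < y <= l) ->
  (forall e, 0 < e -> exists2 y, A `|y| & r <= y < r + e) ->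
  let s := exit_time (W ^~ w) (x - (l + r) / 2) ((r - l) / 2) in
  (forall t, 0 <= t -> t < s -> `|x - (l + r) / 2 + W t w| < (r - l) / 2) ->
  payoff W x A w = (discount s * `|x + W s w|)%:E.
Proof.
move=> lx xr gap accl accr s reg.
have [W0 cW _ _] := tW w.
have c_path : continuous (fun t : R => x + W t w).
  by move=> t; apply: cvgD; [exact: cvg_cst|exact: cW].
have s0 : 0 <= s by exact: exit_time_ge0.
have no_hit t : 0 < t -> t < s -> ~ A `|x + W t w|.
  move=> t0 ts; have := reg _ (ltW t0) ts; rewrite ltr_norml => /andP[h1 h2].
  by apply: gap; lra.
have hit e : 0 < e -> exists t, [/\ 0 < t, t < s + e & A `|x + W t w|].
  move=> e0.
  have [t [st te ht]] := after_exit_time (tW w) (x - (l + r) / 2) ((r - l) / 2) e0.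
  rewrite -/s in st te; have t0 : 0 <= t := le_trans s0 st.
  suff [a Aa [v vI vE]] : exists2 a, A `|a| & exists2 v, v \in `[0, t] & x + W v w = a.
    move: vI; rewrite in_itv/= => /andP[v0 vt]; exists v; split.
    - rewrite lt_neqAle v0 andbT eq_sym; apply/eqP => v0'.
      move: vE; rewrite v0' W0 addr0 => xa.
      by apply: (gap x) => //; rewrite xa.
    - exact: le_lt_trans te.
    - by rewrite vE.
  have ivt a : Num.min x (x + W t w) <= a <= Num.max x (x + W t w) ->
      exists2 v, v \in `[0, t] & x + W v w = a.
    move=> Ha; apply: (IVT t0 (continuous_subspaceT c_path)).
    by rewrite W0 addr0.
  move: ht; rewrite ltr_normr => /orP[H|H].
  - have e1 : 0 < x + W t w - r by lra.
    have [a Aa /andP[ra ae]] := accr _ e1.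
    exists a => //; apply: ivt; rewrite ge_min le_max; apply/andP; split; apply/orP; [left|right]; lra.
  - have e1 : 0 < l - (x + W t w) by lra.
    have [a Aa /andP[al la]] := accl _ e1.
    exists a => //; apply: ivt; rewrite ge_min le_max; apply/andP; split; apply/orP; [right|left]; lra.
case: (payoffP x A w) => [_ never|t t0 _ -> before after].
  by have [t [t0 _ At]] := hit 1 ltr01; case: (never t t0).
suff -> : t = s by [].
apply/eqP; rewrite eq_le; apply/andP; split.
- apply/ler_addgt0Pr => e e0; have [v [v0 ve Av]] := hit e e0.
  apply: le_trans (ltW ve); rewrite leNgt; apply/negP => vt.
  exact: (before v).
- rewrite leNgt; apply/negP => ts.
  have e0 : 0 < s - t by rewrite subr_gt0.
  have [v [v0 tv vs Av]] := after _ e0.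
  by apply: (no_hit v) => //; move: vs; rewrite addrC subrK.
Qed.

End payoff.

(** * Mixtures of exponential discounts *)

Section exponential_mixture.
Context {R : realType}.

Definition expo : probability (measurableTypeR R) R.
Proof. refine (exponential_prob (1 : R)); exact: ltr01. Defined.

Lemma integral_expo (f : R -> \bar R) :
  measurable_fun setT f -> (forall s, 0 <= f s)%E ->
  (\int[expo]_s f s =
   \int[lebesgue_measure]_(s in `[0%R, +oo[) (f s * (expR (- s))%:E))%E.
Proof.
move=> mf f0.
rewrite (@ge0_integral_density _ _ _ lebesgue_measure expo (exponential_pdf 1))//.
- rewrite [RHS]integral_mkcond; apply: eq_integral => s _.
  rewrite patchE; have [s0|s0] := lerP 0 s.
    rewrite mem_set; last by rewrite /= in_itv/= s0.
    by rewrite exponential_pdfE// mul1r mulN1r.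
  rewrite memNset; last by rewrite /= in_itv/= andbT; apply/negP; rewrite -ltNge.
  by rewrite lt0_exponential_pdf// mule0.
- exact: measurable_exponential_pdf.
- by move=> s; exact: exponential_pdf_ge0.
Qed.

Lemma expo_le0 : expo [set s : R | s <= 0] = 0%E.
Proof.
have -> : [set s : R | s <= 0] = `]-oo, 0%R]%classic.
  by apply/seteqP; split => s /=; rewrite in_itv.
rewrite [LHS]/(\int[lebesgue_measure]_(x in `]-oo, 0%R]) (exponential_pdf (1 : R) x)%:E)%E.
transitivity (\int[lebesgue_measure]_(x in `]-oo, 0%R[) (exponential_pdf (1 : R) x)%:E)%E.
  apply/esym; apply: integral_itv_bndo_bndc.
  by apply/measurable_funTS/measurable_EFinP; exact: measurable_exponential_pdf.
apply: integral0_eq => s /=; rewrite in_itv/= => s0.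
by rewrite lt0_exponential_pdf.
Qed.

(** Nonnegative [k] produces the discount; k = -1/2 gives the exponential moment that dominates
    functions of [frequency]. *)
Lemma expo_laplace (k : R) : -1 < k ->
  (\int[expo]_s (expR (- (k * s)))%:E = (1 / (1 + k))%:E)%E.
Proof.
move=> k1; have k0 : 0 < 1 + k by lra.
rewrite integral_expo//; last first.
  apply/measurable_EFinP; apply: measurableT_comp => //.
  by apply: measurableT_comp => //; exact: measurable_funM.
transitivity (\int[lebesgue_measure]_s ((1 / (1 + k))%:E * (exponential_pdf (1 + k) s)%:E))%E.
  rewrite integral_mkcond; apply: eq_integral => s _; rewrite patchE.
  have [s0|s0] := lerP 0 s.
    rewrite mem_set; last by rewrite /= in_itv/= s0.
    rewrite exponential_pdfE// -!EFinM -expRD mulrA divfK ?gt_eqF// mul1r.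
    by congr (expR _)%:E; ring.
  rewrite memNset; last by rewrite /= in_itv/= andbT; apply/negP; rewrite -ltNge.
  by rewrite lt0_exponential_pdf// mule0.
rewrite ge0_integralZl//.
- by rewrite integral_exponential_pdf// mule1.
- by apply/measurable_EFinP; exact: measurable_exponential_pdf.
- by move=> s _; rewrite lee_fin exponential_pdf_ge0// ltW.
- by rewrite lee_fin divr_ge0// ltW.
Qed.

Let mle0 : measurable ([set s : R | s <= 0] : set (measurableTypeR R)).
Proof.
have -> : [set s : R | s <= 0] = `]-oo, 0%R]%classic.
  by apply/seteqP; split => s /=; rewrite in_itv.
exact: measurable_itv.
Qed.

(** Comparison is asked for s > 0 only, where [frequency] is positive and its square is 2 beta s. *)
Lemma ge0_le_integral_expo (f g : R -> \bar R) :
  (forall s, 0 <= f s)%E -> (forall s, 0 <= g s)%E ->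
  (forall s, (0 < s)%R -> f s <= g s)%E ->
  (\int[expo]_s f s <= \int[expo]_s g s)%E.
Proof.
move=> f0 g0 fg; apply: (ge0_le_integral_outside mle0 expo_le0) => // s /negP.
by rewrite -ltNge; exact: fg.
Qed.

Lemma ge0_eq_integral_expo (f g : R -> \bar R) :
  (forall s, 0 <= f s)%E -> (forall s, 0 <= g s)%E ->
  (forall s, (0 < s)%R -> f s = g s)%E ->
  (\int[expo]_s f s = \int[expo]_s g s)%E.
Proof.
move=> f0 g0 fg; apply: (ge0_eq_integral_outside mle0 expo_le0) => // s /negP.
by rewrite -ltNge; exact: fg.
Qed.

Let ae_expo (Q : R -> Prop) : (forall s, 0 < s -> Q s) ->
  {ae expo, forall s, Q s}.
Proof.
move=> HQ; exists [set s : R | s <= 0]; split; [exact: mle0|exact: expo_le0|].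
by move=> s /= nQ; rewrite leNgt; apply/negP => /HQ.
Qed.

Let expo_ae_pos (Q : R -> Prop) : {ae expo, forall s, Q s} ->
  exists2 s, 0 < s & Q s.
Proof.
move=> [N [mN N0 HN]]; apply: contrapT => H.
have U0 : (expo (N `|` [set s : R | (s <= 0)%R]) <= 0)%E.
  have := @measureU2 _ _ _ expo _ _ mN mle0.
  by rewrite /= [X in (X + _)%E]N0 [X in (_ + X)%E]expo_le0 adde0.
have H1 : (1 <= expo (N `|` [set s : R | (s <= 0)%R]))%E.
  rewrite -(@probability_setT _ _ _ expo).
  apply: le_measure; rewrite ?inE//; first exact: measurableU.
  move=> s _; have [s0|s0] := lerP s 0; [by right|left; apply: HN => /= Qs].
  by apply: H; exists s.
by have := le_trans H1 U0; rewrite leNgt lte01.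
Qed.

Lemma Rintegral_expo_ge0 (f : R -> R) :
  expo.-integrable setT (EFin \o f) -> (forall s, 0 < s -> 0 <= f s) ->
  0 <= \int[expo]_s f s.
Proof.
move=> fi f0; rewrite /Rintegral fine_ge0//.
have mf := measurable_int _ fi.
have -> : (\int[expo]_s (f s)%:E = \int[expo]_s `|f s|%:E)%E.
  apply: ae_eq_integral => //; first exact: (measurableT_comp (@abse_measurable _ _) mf).
  by apply: ae_expo => s s0 _ /=; rewrite ger0_norm// f0.
by apply: integral_ge0 => s _; rewrite lee_fin.
Qed.

(** A zero integral would make [f] vanish almost everywhere, in particular at some s > 0. *)
Lemma Rintegral_expo_gt0 (f : R -> R) :
  expo.-integrable setT (EFin \o f) -> (forall s, 0 < s -> 0 < f s) ->
  0 < \int[expo]_s f s.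
Proof.
move=> fi f0; rewrite lt_neqAle Rintegral_expo_ge0//; last by move=> s /f0/ltW.
rewrite andbT eq_sym; apply/eqP => I0.
have mf := measurable_int _ fi.
have I0' : (\int[expo]_s `|(EFin \o f) s| = 0)%E.
  rewrite -[RHS](_ : 0%:E = 0%E)// -I0 /Rintegral fineK; last exact: integrable_fin_num.
  apply: ae_eq_integral => //; first exact: measurableT_comp.
  by apply: ae_expo => s s0 _ /=; rewrite ger0_norm// ltW// f0.
have /ae_eq_integral_abs : (\int[expo]_(x in setT) `|(EFin \o f) x| = 0)%E := I0'.
move=> /(_ measurableT mf) H.
have [s s0 fs] := expo_ae_pos H.
by have := f0 s s0; have /= := fs Logic.I; move=> [->]; rewrite ltxx.
Qed.

Lemma lt_Rintegral_expo (f g : R -> R) :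
  expo.-integrable setT (EFin \o f) -> expo.-integrable setT (EFin \o g) ->
  (forall s, 0 < s -> f s < g s) -> \int[expo]_s f s < \int[expo]_s g s.
Proof.
move=> fi gi fg; rewrite -subr_gt0 -RintegralB//.
apply: Rintegral_expo_gt0; last by move=> s /fg; rewrite subr_gt0.
exact: (integrableB measurableT gi fi).
Qed.

Lemma le_Rintegral_expo (f g : R -> R) :
  expo.-integrable setT (EFin \o f) -> expo.-integrable setT (EFin \o g) ->
  (forall s, 0 < s -> f s <= g s) -> \int[expo]_s f s <= \int[expo]_s g s.
Proof.
move=> fi gi fg; rewrite -subr_ge0 -RintegralB//.
apply: Rintegral_expo_ge0; last by move=> s /fg; rewrite subr_ge0.
exact: (integrableB measurableT gi fi).
Qed.

Lemma Rintegral_expo_cst (c : R) : \int[expo]_s c = c.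
Proof.
rewrite /Rintegral integral_cst//.
transitivity (fine (c%:E * 1)%E); last by rewrite mule1.
by congr (fine (_ * _)%E); exact: (@probability_setT _ _ _ expo).
Qed.

End exponential_mixture.

Section discount_mixture.
Context {R : realType} {d : measure_display} {Omega : measurableType d}.
Variables (P : probability Omega R) (beta : R) (beta0 : 0 < beta).

Definition frequency (s : R) : R := Num.sqrt (2 * beta * s).
Local Notation freq := frequency.

Lemma freq_ge0 s : 0 <= freq s. Proof. exact: sqrtr_ge0. Qed.

Lemma freq_gt0 s : 0 < s -> 0 < freq s.
Proof. by move=> s0; rewrite sqrtr_gt0 !mulr_gt0. Qed.

Lemma freq_sqr s : 0 < s -> freq s ^+ 2 = 2 * beta * s.
Proof. by move=> s0; rewrite sqr_sqrtr// !mulr_ge0// ltW. Qed.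

Lemma freq_le s t : s <= t -> freq s <= freq t.
Proof. by move=> st; rewrite ler_wsqrtr// ler_wpM2l// mulr_ge0// ltW. Qed.

Lemma continuous_freq : continuous freq.
Proof.
move=> s; apply: (cvg_comp (fun s => 2 * beta * s) (@Num.sqrt R)).
  by apply: cvgM; [exact: cvg_cst|exact: cvg_id].
exact: sqrt_continuous.
Qed.

Lemma measurable_freq_comp (phi : R -> R) : continuous phi ->
  measurable_fun setT (fun s => phi (freq s)).
Proof.
move=> cphi; apply: continuous_measurable_fun => s.
apply: continuous_comp; [exact: continuous_freq|exact: cphi].
Qed.

Lemma discount_mixture (sigma Phi : Omega -> R) :
  measurable_fun setT sigma -> (forall w, 0 <= sigma w) ->
  measurable_fun setT Phi -> (forall w, 0 <= Phi w) ->
  (\int[P]_w (discount beta (sigma w) * Phi w)%:E =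
   \int[expo]_s \int[P]_w (expR (- (freq s ^+ 2 / 2 * sigma w)) * Phi w)%:E)%E.
Proof.
move=> ms s0 mP P0.
pose F (z : Omega * measurableTypeR R) :=
  (expR (- (freq z.2 ^+ 2 / 2 * sigma z.1)) * Phi z.1)%:E.
have mF : measurable_fun setT F.
  apply/measurable_EFinP; apply: measurable_funM; last exact: measurableT_comp mP _.
  apply: measurableT_comp => //; apply: measurableT_comp => //.
  apply: measurable_funM; last exact: measurableT_comp ms _.
  apply: measurable_funM => //; apply: measurable_funX.
  apply: (@measurableT_comp _ _ _ _ _ _ freq _ snd) => //.
  by apply: continuous_measurable_fun; exact: continuous_freq.
have F0 z : (0 <= F z)%E by rewrite lee_fin mulr_ge0// expR_ge0.
rewrite -[RHS](@fubini_tonelli _ _ _ _ _ P expo F mF F0).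
apply: eq_integral => w _; rewrite /F /=.
have bs : -1 < beta * sigma w.
  by apply: (@lt_le_trans _ _ 0); rewrite ?ltrN10// mulr_ge0// ltW.
rewrite /discount EFinM -expo_laplace// muleC -ge0_integralZl//; last 2 first.
- apply/measurable_EFinP; apply: measurableT_comp => //.
  by apply: measurableT_comp => //; exact: measurable_funM.
- by rewrite lee_fin.
apply: ge0_eq_integral_expo => s.
- by rewrite mule_ge0// lee_fin// expR_ge0.
- by rewrite lee_fin mulr_ge0// expR_ge0.
- move=> sp; rewrite -EFinM mulrC; congr ((expR _ * _)%:E).
  by rewrite freq_sqr//; field.
Qed.

End discount_mixture.

(** * Monotonicity of tanh and of ratios of cosh *)

Section hyperbolic_tangent.
Context {R : realType}.
Implicit Types a b u v x r : R.

Lemma tanhE x : tanh x = sinh x / cosh x.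
Proof.
by rewrite /tanh /sinh /cosh invfM invrK mulrACA mulVf ?mulr1// pnatr_eq0.
Qed.

Lemma tanh_sub a b : tanh b - tanh a = sinh (b - a) / (cosh a * cosh b).
Proof.
rewrite !tanhE sinhD coshN sinhN; field.
by rewrite !gt_eqF ?cosh_gt0.
Qed.

Lemma tanh_ge0 a : 0 <= a -> 0 <= tanh a.
Proof. by move=> a0; rewrite tanhE divr_ge0 ?sinh_ge0// ltW// cosh_gt0. Qed.

Lemma tanh_gt0 a : 0 < a -> 0 < tanh a.
Proof. by move=> a0; rewrite tanhE divr_gt0 ?sinh_gt0// cosh_gt0. Qed.

Lemma tanh_le1 a : tanh a <= 1.
Proof.
rewrite tanhE ler_pdivrMr ?cosh_gt0// mul1r /sinh /cosh.
have := expR_ge0 (- a); lra.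
Qed.

Lemma ler_tanh a b : a <= b -> tanh a <= tanh b.
Proof.
move=> ab; rewrite -subr_ge0 tanh_sub divr_ge0 ?sinh_ge0 ?subr_ge0//.
by rewrite ltW// mulr_gt0// cosh_gt0.
Qed.

Lemma tanh_sub_le a b : 0 <= a -> a <= b -> tanh b - tanh a <= 2 * (b - a).
Proof.
move=> a0 ab; have cc : 0 < cosh a * cosh b by apply: mulr_gt0; exact: cosh_gt0.
rewrite tanh_sub ler_pdivrMr//.
have d0 : 0 <= b - a by rewrite subr_ge0.
have := sinh_sub_le (lexx 0) d0; rewrite sinh0 !subr0 => /le_trans; apply.
apply: ler_wpM2l; first by rewrite mulr_ge0.
apply: (@le_trans _ _ (cosh b)).
  by apply: ler_cosh; rewrite !ger0_norm//; lra.
by rewrite ler_peMl ?cosh_ge1// ltW// cosh_gt0.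
Qed.

(** After clearing denominators, the product formula for [cosh] reduces the claim to v x + u r <= u
    x + v r and |v x - u r| <= v r - u x. *)
Lemma cosh_ratio_anti x r u v : 0 <= x -> x <= r -> 0 <= u -> u <= v ->
  cosh (v * x) / cosh (v * r) <= cosh (u * x) / cosh (u * r).
Proof.
move=> x0 xr u0 uv; rewrite ler_pdivrMr ?cosh_gt0// mulrAC ler_pdivlMr ?cosh_gt0//.
have coshM a b : cosh a * cosh b = (cosh (a + b) + cosh (a - b)) / 2.
  by rewrite !coshD coshN sinhN; field.
rewrite !coshM ler_pM2r ?invr_gt0//.
have r0 : 0 <= r := le_trans x0 xr.
have v0 : 0 <= v := le_trans u0 uv.
have xru : 0 <= (r - x) * (v - u) by rewrite mulr_ge0 ?subr_ge0.
have xru' : 0 <= (r + x) * (v - u) by rewrite mulr_ge0 ?subr_ge0// addr_ge0.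
have xru'' : 0 <= (r - x) * (v + u) by rewrite mulr_ge0 ?subr_ge0// addr_ge0.
have p1 : 0 <= v * x by rewrite mulr_ge0.
have p2 : 0 <= u * r by rewrite mulr_ge0.
have p3 : 0 <= u * x by rewrite mulr_ge0.
have p4 : 0 <= v * r by rewrite mulr_ge0.
apply: lerD; apply: ler_cosh.
  rewrite !ger0_norm ?addr_ge0//; lra.
rewrite [leRHS]distrC [leRHS]ger0_norm; last lra.
by rewrite ler_norml; apply/andP; split; lra.
Qed.

End hyperbolic_tangent.

Section expo_association.
Context {R : realType}.

(* Chebyshev's association inequality, in the form where the second function
   only has to have a nonnegative mean. *)
Lemma Rintegral_expo_association (F H : R -> R) :
  (forall s, 0 < s -> 0 <= F s) ->
  (forall s t, 0 < s -> s <= t -> F t <= F s) ->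
  (forall s t, 0 < s -> s <= t -> H t <= H s) ->
  expo.-integrable setT (EFin \o H) ->
  expo.-integrable setT (EFin \o (fun s => F s * H s)) ->
  0 <= \int[expo]_s H s -> 0 <= \int[expo]_s (F s * H s).
Proof.
move=> F0 Fd Hd Hi FHi H0.
have [Hpos|/existsNP[t0 /not_implyP[t00 /negP]]] :=
    pselect (forall s, 0 < s -> 0 <= H s).
  by apply: Rintegral_expo_ge0 => // s s0; rewrite mulr_ge0 ?F0 ?Hpos.
rewrite -ltNge => Ht0.
(* The number sup S separates the values of [F] where H >= 0, which are above it, from those where H
   < 0, so that F H >= (sup S) H pointwise. *)
pose S : set R := [set F t | t in [set t : R | 0 < t /\ H t < 0]].
(* A point where H >= 0 exists since the mean of [H] is nonnegative; it bounds [S]. *)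
have [s1 s10 Hs1] : exists2 s, 0 < s & 0 <= H s.
  apply: contrapT => /forall2NP nH.
  have := Rintegral_expo_gt0 (f := fun s => - 1 * H s).
  rewrite RintegralZl// => /(_ (integrableZl measurableT (-1) Hi)) K.
  have : 0 < -1 * \int[expo]_s H s.
    by apply: K => s s0; case: (nH s) => // /negP; rewrite -ltNge mulN1r oppr_gt0.
  by rewrite mulN1r oppr_gt0 ltNge H0.
have SF s : 0 < s -> 0 <= H s -> ubound S (F s).
  move=> s0 Hs _ [t [tp Ht] <-]; apply: Fd => //.
  rewrite leNgt; apply/negP => ts; have := Hd _ _ tp (ltW ts).
  by move=> /le_lt_trans /(_ Ht); rewrite ltNge Hs.
have SN : S !=set0 by exists (F t0); exists t0.
have Sub : has_ubound S by exists (F s1); exact: SF.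
have c0 : 0 <= sup S.
  by apply: (le_trans (F0 _ t00)); apply: (ub_le_sup Sub); exists t0.
apply: (@le_trans _ _ (\int[expo]_s (sup S * H s))).
  by rewrite RintegralZl// mulr_ge0.
apply: le_Rintegral_expo => //; first exact: (integrableZl measurableT _ Hi).
move=> s s0; have [Hs|Hs] := lerP 0 (H s).
  by apply: ler_wpM2r => //; apply: ge_sup => //; exact: SF.
apply: ler_wnM2r; first exact: ltW.
by apply: (ub_le_sup Sub); exists s.
Qed.
End expo_association.

(** * The threshold *)

Section threshold_function.
Context {R : realType}.
Variables (beta : R) (beta0 : 0 < beta).
Local Notation freq := (frequency beta).
Implicit Types a b x r : R.

(** For s > 0, u^2 = 2 beta s is at most 4 beta exp(s / 2), which is integrable against exp(-s); for
    s <= 0 the frequency is 0. *)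
Lemma integrable_freq (phi : R -> R) (c : R) : continuous phi ->
  (forall u, 0 <= u -> `|phi u| <= c * (1 + u ^+ 2)) ->
  expo.-integrable setT (EFin \o (fun s => phi (freq s))).
Proof.
move=> cphi bphi.
have c0 : 0 <= c.
  have := le_trans (normr_ge0 _) (bphi 0 (lexx _)).
  by rewrite expr0n addr0 mulr1.
have ie : expo.-integrable setT (EFin \o (fun s : R => expR (- (- 2^-1 * s)))).
  apply/integrableP; split.
    apply/measurable_EFinP; apply: measurableT_comp => //.
    by apply: measurableT_comp => //; exact: measurable_funM.
  under eq_integral do rewrite /= ger0_norm ?expR_ge0//.
  by rewrite expo_laplace ?ltry//; lra.
have ie1 := integrableD measurableT ie (finite_measure_integrable_cst expo (1 : R) measurableT).
have cb0 : 0 <= c * (1 + 4 * beta) by rewrite mulr_ge0// addr_ge0// mulr_ge0// ltW.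
apply: (le_integrable measurableT _ _ (integrableZl measurableT (c * (1 + 4 * beta)) ie1)).
  by apply/measurable_EFinP; exact: measurable_freq_comp.
move=> s _; rewrite /= lee_fin mulNr opprK.
have e0 := expR_gt0 (2^-1 * s).
rewrite [leRHS]ger0_norm; last by rewrite mulr_ge0// addr_ge0// ltW.
apply: (le_trans (bphi _ (freq_ge0 _ _))).
rewrite -mulrA ler_wpM2l//.
have be0 : 0 < beta * expR (2^-1 * s) by rewrite mulr_gt0.
have [s0|s0] := ltrP 0 s.
  rewrite freq_sqr//; have h1 := expR_ge1Dx (2^-1 * s).
  have h3 : beta * (s / 2) <= beta * expR (2^-1 * s) by rewrite ler_pM2l//; lra.
  have := beta0; lra.
have -> : freq s = 0.
  by rewrite /frequency ler0_sqrtr// mulr_ge0_le0// mulr_ge0// ltW.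
rewrite expr0n addr0; have := beta0; lra.
Qed.

(** The left derivative at x = a of the mean of cosh(theta x) / cosh(theta a). With it,
    [threshold_fun] and [exit_value] are G and v. *)
Definition threshold_slope a := \int[expo]_s (freq s * tanh (freq s * a)).
Definition threshold_fun a := a * threshold_slope a.
Definition exit_value x r := r * \int[expo]_s (cosh (freq s * x) / cosh (freq s * r)).

Let continuous_cosh (a : R) : continuous (fun u : R => cosh (u * a)).
Proof.
move=> u; apply: cvgM; last exact: cvg_cst.
have ua : (fun u : R => u * a) x @[x --> u] --> u * a.
  by apply: cvgM; [exact: cvg_id|exact: cvg_cst].
apply: cvgD; apply: continuous_comp; [exact: ua|exact: continuous_expR| |exact: continuous_expR].
exact: cvgN.
Qed.

Let continuous_sinh (a : R) : continuous (fun u : R => sinh (u * a)).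
Proof.
move=> u; apply: cvgM; last exact: cvg_cst.
have ua : (fun u : R => u * a) x @[x --> u] --> u * a.
  by apply: cvgM; [exact: cvg_id|exact: cvg_cst].
apply: cvgB; apply: continuous_comp; [exact: ua|exact: continuous_expR| |exact: continuous_expR].
exact: cvgN.
Qed.

Let continuous_ratio (p : R -> R) a : continuous p ->
  continuous (fun u : R => p u / cosh (u * a)).
Proof.
move=> cp u; apply: cvgM; first exact: cp.
by apply: cvgV; [rewrite gt_eqF// cosh_gt0|exact: continuous_cosh].
Qed.

Lemma integrable_slope a : expo.-integrable setT
  (EFin \o (fun s => freq s * tanh (freq s * a))).
Proof.
apply: (@integrable_freq (fun u => u * tanh (u * a)) 1).
  have ct : continuous (fun u : R => tanh (u * a)).
    rewrite (_ : (fun u => _) = fun u : R => sinh (u * a) / cosh (u * a)).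
      exact: (continuous_ratio (@continuous_sinh a)).
    by apply/funext => v; rewrite tanhE.
  by move=> u; apply: cvgM; [exact: cvg_id|exact: ct].
move=> u u0; rewrite normrM ger0_norm// mul1r.
have t1 : `|tanh (u * a)| <= 1.
  rewrite ler_norml tanh_le1 andbT lerNl.
  rewrite (_ : - tanh (u * a) = tanh (- (u * a))) ?tanh_le1//.
  by rewrite !tanhE sinhN coshN mulNr.
have := ler_wpM2l u0 t1; have := sqr_ge0 (u - 1); lra.
Qed.

Lemma integrable_cosh_ratio x r : 0 <= x -> x <= r -> expo.-integrable setT
  (EFin \o (fun s => cosh (freq s * x) / cosh (freq s * r))).
Proof.
move=> x0 xr.
apply: (@integrable_freq (fun u => cosh (u * x) / cosh (u * r)) 1).
  exact: (continuous_ratio (@continuous_cosh x)).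
move=> u u0; rewrite ger0_norm; last by rewrite divr_ge0// ltW// cosh_gt0.
rewrite mul1r (@le_trans _ _ 1)//; last by rewrite lerDl sqr_ge0.
rewrite ler_pdivrMr ?cosh_gt0// mul1r; apply: ler_cosh.
have r0 : 0 <= r := le_trans x0 xr.
by rewrite !ger0_norm ?mulr_ge0// ler_wpM2l.
Qed.

Lemma integrable_freq_sqr : expo.-integrable setT (EFin \o (fun s => freq s ^+ 2)).
Proof.
apply: (@integrable_freq (fun u => u ^+ 2) 1); first exact: exprn_continuous.
by move=> u u0; rewrite ger0_norm ?sqr_ge0// mul1r lerDr.
Qed.

Lemma threshold_slope_gt0 a : 0 < a -> 0 < threshold_slope a.
Proof.
move=> a0; apply: Rintegral_expo_gt0; first exact: integrable_slope.
by move=> s s0; rewrite mulr_gt0 ?freq_gt0// tanh_gt0// mulr_gt0// freq_gt0.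
Qed.

Lemma threshold_slope_le a b : a <= b -> threshold_slope a <= threshold_slope b.
Proof.
move=> ab; apply: le_Rintegral_expo; [exact: integrable_slope|exact: integrable_slope|].
by move=> s s0; rewrite ler_wpM2l ?freq_ge0// ler_tanh// ler_wpM2l// freq_ge0.
Qed.

Lemma threshold_fun_lt a b : 0 < a -> a < b -> threshold_fun a < threshold_fun b.
Proof.
move=> a0 ab; apply: (@lt_le_trans _ _ (b * threshold_slope a)).
  by rewrite /threshold_fun ltr_pM2r ?threshold_slope_gt0.
by rewrite /threshold_fun ler_pM2l ?(lt_trans a0)// threshold_slope_le// ltW.
Qed.

(** The second moment of the frequency, which bounds all second-order errors below; only its
    finiteness matters. *)
Let K := \int[expo]_s (freq s ^+ 2).

Let K0 : 0 <= K.
Proof. by apply: Rintegral_ge0 => s _; exact: sqr_ge0. Qed.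

Lemma threshold_slope_sub a b : 0 <= a -> a <= b ->
  threshold_slope b - threshold_slope a <= 2 * (b - a) * K.
Proof.
move=> a0 ab; rewrite /threshold_slope -RintegralB//; [|exact: integrable_slope..].
rewrite /K -RintegralZl//; last exact: integrable_freq_sqr.
apply: le_Rintegral_expo.
- exact: (integrableB measurableT (integrable_slope b) (integrable_slope a)).
- exact: (integrableZl measurableT _ integrable_freq_sqr).
move=> s s0; rewrite -mulrBr; have f0 := freq_gt0 beta0 s0.
have := @tanh_sub_le R (freq s * a) (freq s * b).
rewrite mulr_ge0 ?(ltW f0)// ler_pM2l// => /(_ isT ab) H.
apply: (le_trans (ler_wpM2l (ltW f0) H)); lra.
Qed.

Lemma continuous_threshold_fun b : {within `[0, b], continuous threshold_fun}.
Proof.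
have cs : {within `[0, b], continuous threshold_slope}.
  apply/subspace_continuousP => x /=; rewrite in_itv/= => /andP[x0 xb].
  apply/cvgrPdist_le => e e0; rewrite near_withinE; near=> z => /=.
  rewrite in_itv/= => /andP[z0 zb].
  have zx : `|x - z| * (2 * K) <= e.
    have : `|x - z| <= e / (2 * K + 1).
      near: z; apply/nbhs_ballP; exists (e / (2 * K + 1)) => /=.
        by rewrite divr_gt0// ltr_wpDl// mulr_ge0.
      by move=> z; rewrite /ball/= => /ltW.
    rewrite ler_pdivlMr ?ltr_wpDl ?mulr_ge0//.
    by apply: le_trans; rewrite ler_wpM2l// lerDl.
  apply: le_trans zx; have [xz|/ltW zx] := lerP x z.
    rewrite distrC ger0_norm ?subr_ge0 ?threshold_slope_le//.
    by apply: (le_trans (threshold_slope_sub x0 xz)); lra.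
  rewrite ger0_norm ?subr_ge0 ?threshold_slope_le//.
  by apply: (le_trans (threshold_slope_sub z0 zx)); lra.
move=> x; apply: cvgM; last exact: cs.
exact: (continuous_subspaceT (fun x => @cvg_id _ (nbhs x))).
Unshelve. all: by end_near.
Qed.

Lemma threshold_fun_root : exists2 a, 0 < a & threshold_fun a = 1.
Proof.
have s1 := threshold_slope_gt0 ltr01.
(* As the slope is nondecreasing, G(b) >= b [threshold_slope] 1 = [threshold_slope] 1 + 1. *)
pose b := 1 + (threshold_slope 1)^-1.
have i0 : 0 < (threshold_slope 1)^-1 by rewrite invr_gt0.
have b1 : 1 <= b by rewrite lerDl ltW.
have b0 : 0 <= b := le_trans ler01 b1.
have Gb : 1 <= threshold_fun b.
  apply: (@le_trans _ _ (b * threshold_slope 1)).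
    by rewrite mulrDl mulVf ?gt_eqF// lerDr mul1r ltW.
  by rewrite /threshold_fun ler_wpM2l// threshold_slope_le.
have G0 : threshold_fun 0 = 0 by rewrite /threshold_fun mul0r.
have [a aI Ga] : exists2 a, a \in `[0, b] & threshold_fun a = 1.
  apply: (IVT b0 (@continuous_threshold_fun b)).
  by rewrite G0 ge_min le_max Gb ler01 orbT.
exists a => //; move: aI; rewrite in_itv/= => /andP[a0 _].
rewrite lt_neqAle a0 andbT eq_sym; apply/eqP => a0'.
by move: Ga; rewrite a0' G0 => /eqP; rewrite eq_sym oner_eq0.
Qed.

Lemma threshold_fun_inj a b : 0 < a -> 0 < b ->
  threshold_fun a = threshold_fun b -> a = b.
Proof.
move=> a0 b0 E; apply/eqP; rewrite eq_le !leNgt; apply/andP; split; apply/negP.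
  by move=> /(threshold_fun_lt b0); rewrite E ltxx.
by move=> /(threshold_fun_lt a0); rewrite E ltxx.
Qed.

(** Turns the extended-real Lebesgue integral with weight exp(-s) into a real mean under [expo]. *)
Lemma thresholdP a : threshold beta a <-> 0 < a /\ threshold_fun a = 1.
Proof.
have E : 0 < a -> (a%:E * \int[lebesgue_measure]_(s in `[0%R, +oo[)
    (expR (- s) * Num.sqrt (2 * beta * s) *
      tanh (a * Num.sqrt (2 * beta * s)))%R%:E = (threshold_fun a)%:E)%E.
  move=> a0; rewrite /threshold_fun EFinM; congr (_ * _)%E.
  rewrite /threshold_slope /Rintegral fineK; last first.
    by apply: integrable_fin_num => //; exact: integrable_slope.
  rewrite integral_expo.
  - apply: eq_integral => s _; rewrite -EFinM; congr (_%:E).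
    by rewrite /frequency (mulrC a); ring.
  - exact: (measurable_int _ (integrable_slope a)).
  - move=> s; rewrite lee_fin mulr_ge0 ?freq_ge0// tanh_ge0// mulr_ge0 ?freq_ge0// ltW//.
by split => -[a0 H]; split => //; [move: H; rewrite E// => -[]|rewrite E// H].
Qed.

Lemma threshold_exists_unique : exists! a, threshold beta a.
Proof.
have [a a0 Ga] := threshold_fun_root.
exists a; split; first exact/thresholdP.
move=> b /thresholdP[b0 Gb]; apply: threshold_fun_inj => //.
by rewrite Ga Gb.
Qed.

(** The tangent to [cosh] at theta a lies strictly below the graph. Averaged and multiplied by [a],
    it gives a - (a - x) G(a), which is x. *)
Lemma exit_value_gt x a : 0 <= x -> x < a -> threshold_fun a = 1 ->
  x < exit_value x a.
Proof.
move=> x0 xa Ga; have a0 : 0 < a := le_lt_trans x0 xa.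
have lb : 1 - (a - x) * threshold_slope a <
    \int[expo]_s (cosh (freq s * x) / cosh (freq s * a)).
  rewrite -{1}[1]Rintegral_expo_cst -RintegralZl//; last exact: integrable_slope.
  have i1 := finite_measure_integrable_cst expo (1 : R) measurableT.
  have i2 := integrableZl measurableT (a - x) (integrable_slope a).
  rewrite -RintegralB//; apply: lt_Rintegral_expo.
  - exact: (integrableB measurableT i1 i2).
  - exact: integrable_cosh_ratio (ltW xa).
  move=> s s0; have f0 := freq_gt0 beta0 s0.
  rewrite ltr_pdivlMr ?cosh_gt0// tanhE.
  have : freq s * x != freq s * a by rewrite lt_eqF// ltr_pM2l.
  move=> /cosh_tangent_lt; apply: le_lt_trans.
  rewrite le_eqVlt; apply/orP; left; apply/eqP.
  by field; rewrite gt_eqF ?cosh_gt0.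
move: lb; rewrite -(ltr_pM2l a0) -/(exit_value x a); apply: le_lt_trans.
have -> : a * (1 - (a - x) * threshold_slope a) =
    a - (a - x) * threshold_fun a by rewrite /threshold_fun; ring.
by rewrite Ga; lra.
Qed.

(** Expanding at [r] with a quadratic error, x <= v(x, r) <= r - (r - x) G(r) + 2 r K (r - x)^2.
    Dividing by r - x leaves G(r) <= 1 + 2 r K (r - x), and x tends to r. *)
Lemma threshold_fun_le1 r : 0 < r -> (forall x, 0 <= x -> x < r -> x <= exit_value x r) ->
  threshold_fun r <= 1.
Proof.
move=> r0 H.
have key x : 0 <= x -> x < r -> threshold_fun r <= 1 + 2 * r * K * (r - x).
  move=> x0 xr; have rx0 : 0 < r - x by rewrite subr_gt0.
  have ub : \int[expo]_s (cosh (freq s * x) / cosh (freq s * r)) <=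
      1 - (r - x) * threshold_slope r + 2 * (r - x) ^+ 2 * K.
    rewrite -[X in X - _ + _]Rintegral_expo_cst.
    rewrite /threshold_slope -RintegralZl//; last exact: integrable_slope.
    rewrite /K -[X in _ + X]RintegralZl//; last exact: integrable_freq_sqr.
    have i1 := finite_measure_integrable_cst expo (1 : R) measurableT.
    have i2 := integrableZl measurableT (r - x) (integrable_slope r).
    have i3 := integrableZl measurableT (2 * (r - x) ^+ 2) integrable_freq_sqr.
    have i4 := integrableB measurableT i1 i2.
    rewrite -RintegralB// -RintegralD//; apply: le_Rintegral_expo.
    - exact: integrable_cosh_ratio (ltW xr).
    - exact: (integrableD measurableT i4 i3).
    move=> s s0; have f0 := freq_gt0 beta0 s0.
    rewrite ler_pdivrMr ?cosh_gt0// tanhE.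
    have c0 := cosh_gt0 (freq s * r).
    set S := sinh (freq s * r); set C := cosh (freq s * r).
    have -> : (1 - (r - x) * (freq s * (S / C)) + 2 * (r - x) ^+ 2 * freq s ^+ 2) * C =
        C - (r - x) * freq s * S + 2 * ((r - x) * freq s) ^+ 2 * C.
      by field; rewrite gt_eqF.
    have t1 := cosh_tangent (freq s * r) (freq s * x).
    have fx0 : 0 <= freq s * x by rewrite mulr_ge0// ltW.
    have fxr : freq s * x <= freq s * r by rewrite ler_pM2l// ltW.
    have t2 := sinh_sub_le fx0 fxr.
    rewrite -/C in t1 t2; rewrite -/S in t2.
    have E : freq s * r - freq s * x = (r - x) * freq s by ring.
    rewrite E in t1 t2.
    have p0 : 0 < (r - x) * freq s by rewrite mulr_gt0.
    have t3 := ler_wpM2l (ltW p0) t2.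
    move: t1 t3; move: ((r - x) * freq s) (sinh (freq s * x)) (cosh (freq s * x)) => p u v.
    rewrite expr2; lra.
  have := H x x0 xr; rewrite /exit_value => H1.
  have := le_trans H1 (ler_wpM2l (ltW r0) ub).
  have -> : r * (1 - (r - x) * threshold_slope r + 2 * (r - x) ^+ 2 * K) =
    r - (r - x) * threshold_fun r + (r - x) * (2 * r * K * (r - x)).
    by rewrite /threshold_fun; ring.
  move=> H2.
  have H3 : (r - x) * threshold_fun r <= (r - x) * (1 + 2 * r * K * (r - x)).
    by rewrite mulrDr mulr1; lra.
  by rewrite -(@ler_pM2l _ (r - x)).
apply/ler_addgt0Pr => e e0.
have D0 : 0 < 2 * r * K + 1 by rewrite ltr_wpDl// !mulr_ge0// ltW.
(* Small enough that 2 r K t <= e, and at most [r] so that r - t is a state. *)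
pose t := Num.min r (e / (2 * r * K + 1)).
have t0 : 0 < t by rewrite lt_min r0 divr_gt0.
have tr : t <= r by rewrite ge_min lexx.
have te : t <= e / (2 * r * K + 1) by rewrite ge_min lexx orbT.
have x0 : 0 <= r - t by rewrite subr_ge0.
have xr : r - t < r by rewrite gtrBl.
apply: (le_trans (key _ x0 xr)); rewrite lerD2l opprB addrCA subrr addr0.
move: te; rewrite ler_pdivlMr// mulrDr mulr1 mulrC; lra.
Qed.

Lemma exit_value_mono x r a : 0 <= x -> x <= r -> 0 < r -> r <= a ->
  threshold_fun a = 1 -> exit_value x r <= exit_value x a.
Proof.
move=> x0 xr r0 ra Ga.
have ra_val : r <= exit_value r a.
  move: ra; rewrite le_eqVlt => /predU1P[<-|ra]; last first.
    by rewrite ltW// exit_value_gt// ltW.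
  rewrite /exit_value.
  have -> : \int[expo]_s (cosh (freq s * r) / cosh (freq s * r)) = \int[expo]_s (1 : R).
    by apply: eq_Rintegral => s _; rewrite divff// gt_eqF// cosh_gt0.
  by rewrite Rintegral_expo_cst mulr1.
have iF := integrable_cosh_ratio x0 xr.
have iG := integrable_cosh_ratio (ltW r0) ra.
have iFG := integrable_cosh_ratio x0 (le_trans xr ra).
pose F s := cosh (freq s * x) / cosh (freq s * r).
(* The mean of [H] is v(r, a) - r, and that of F H is v(x, a) - v(x, r). *)
pose H s := a * (cosh (freq s * r) / cosh (freq s * a)) - r.
have a0 : 0 < a := lt_le_trans r0 ra.
have FHE s : F s * H s = a * (cosh (freq s * x) / cosh (freq s * a)) - r * F s.
  by rewrite /F /H; field; rewrite !gt_eqF ?cosh_gt0.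
have ic := finite_measure_integrable_cst expo r measurableT.
have iaG := integrableZl measurableT a iG.
have iH : expo.-integrable setT (EFin \o H).
  exact: (integrableB measurableT iaG ic).
have i1 := integrableZl measurableT a iFG.
have i2 := integrableZl measurableT r iF.
have iFH : expo.-integrable setT (EFin \o (fun s => F s * H s)).
  rewrite (_ : (fun s => F s * H s) = fun s => a * (cosh (freq s * x) / cosh (freq s * a)) - r * F s).
    exact: (integrableB measurableT i1 i2).
  by apply/funext.
have : 0 <= \int[expo]_s (F s * H s).
  apply: Rintegral_expo_association => //.
  - by move=> s _; rewrite divr_ge0// ltW// cosh_gt0.
  - move=> s t s0 st; apply: cosh_ratio_anti => //; first exact: freq_ge0.
    exact: freq_le.
  - move=> s t s0 st; rewrite lerD2r ler_wpM2l ?(ltW a0)//.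
    by apply: cosh_ratio_anti => //; [exact: ltW|exact: freq_ge0|exact: freq_le].
  - rewrite /H RintegralB// RintegralZl// Rintegral_expo_cst subr_ge0.
    exact: ra_val.
have -> : \int[expo]_s (F s * H s) =
    \int[expo]_s (a * (cosh (freq s * x) / cosh (freq s * a)) - r * F s).
  by apply: eq_Rintegral => s _.
by rewrite RintegralB// !RintegralZl// subr_ge0.
Qed.

End threshold_function.

(** * Expected payoffs *)

Section hyperbolic_bound.
Context {R : realType}.

(** Doubling the argument factors the ratio into a ratio of [sinh], at most [a], and a ratio of
    [cosh] at half the argument. The latter is kept: it is below 1 when a < 1, which makes the gap
    estimate strict. *)
Lemma sinh_ratio_le (a q : R) : 0 <= a <= 1 -> 0 < q ->
  sinh (a * q) / sinh q <= a * (cosh (a * (q / 2)) / cosh (q / 2)).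
Proof.
move=> a01 q0; have q20 : 0 < q / 2 by rewrite divr_gt0.
have dbl (u : R) : sinh (u + u) = 2 * sinh u * cosh u by rewrite sinhD; ring.
have qE : q = q / 2 + q / 2 by field.
rewrite {1 2}qE mulrDr !dbl.
have s0 := sinh_gt0 q20; have c0 := cosh_gt0 (q / 2); have ca0 := cosh_gt0 (a * (q / 2)).
have -> : 2 * sinh (a * (q / 2)) * cosh (a * (q / 2)) / (2 * sinh (q / 2) * cosh (q / 2)) =
    sinh (a * (q / 2)) / sinh (q / 2) * (cosh (a * (q / 2)) / cosh (q / 2)).
  by field; rewrite !gt_eqF.
apply: ler_wpM2r; first by rewrite divr_ge0// ltW.
by rewrite ler_pdivrMr// sinh_ratio// ltW.
Qed.

(* The left-hand side solves v'' = theta^2 v on [l, r] with v l = l and v r = r. *)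
Lemma interval_value_le (theta l x r : R) : 0 < theta -> 0 <= l -> l < x -> x < r ->
  (l + r) / 2 * (cosh (theta * (x - (l + r) / 2)) / cosh (theta * ((r - l) / 2))) +
  (r - l) / 2 * sinh (theta * (x - (l + r) / 2)) / sinh (theta * ((r - l) / 2)) <=
  l + (x - l) * (cosh (theta * ((x - l) / 2)) / cosh (theta * ((r - l) / 2))).
Proof.
move=> th0 l0 lx xr.
set y := x - (l + r) / 2; set h := (r - l) / 2.
have h0 : 0 < h by rewrite /h; lra.
have yh : `|y| <= h by rewrite ler_norml /y /h; apply/andP; split; lra.
have thh : 0 < theta * h by rewrite mulr_gt0.
have s0 := sinh_gt0 thh; have c0 := cosh_gt0 (theta * h).
have -> : (l + r) / 2 = l + h by rewrite /h; field.
(* The relative position of [x] in the interval. *)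
pose a := (x - l) / (2 * h).
have a01 : 0 <= a <= 1.
  have h20 : 0 < 2 * h by rewrite mulr_gt0.
  apply/andP; split; first by rewrite divr_ge0 ?(ltW h20)//; lra.
  by rewrite /a ler_pdivrMr// mul1r /h; lra.
have aE : a * (2 * (theta * h)) = theta * (y + h).
  have -> : y + h = x - l by rewrite /y /h; field.
  by rewrite /a; field; rewrite gt_eqF.
have qE : theta * (2 * h) / 2 = theta * h by field.
have q0 : 0 < 2 * (theta * h) by rewrite mulr_gt0.
have := sinh_ratio_le a01 q0.
rewrite aE (_ : 2 * (theta * h) / 2 = theta * h); last by field.
have -> : a * (theta * h) = theta * ((x - l) / 2).
  by rewrite /a; field; rewrite gt_eqF.
(* The solution is l times a ratio of [cosh], plus 2 h sinh(theta (y + h)) / sinh(2 theta h), which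
   pays r - l at the right end only. The addition formulas recover the centred form. *)
have -> : sinh (theta * (y + h)) = sinh (theta * y) * cosh (theta * h) + cosh (theta * y) * sinh (theta * h).
  by rewrite mulrDr sinhD.
have -> : sinh (2 * (theta * h)) = 2 * sinh (theta * h) * cosh (theta * h).
  have -> : 2 * (theta * h) = theta * h + theta * h by ring.
  by rewrite sinhD; ring.
move=> H; have := ler_wpM2l (ltW (mulr_gt0 (ltr0n R 2) h0)) H.
have -> : 2 * h * (a * (cosh (theta * ((x - l) / 2)) / cosh (theta * h))) =
    (x - l) * (cosh (theta * ((x - l) / 2)) / cosh (theta * h)).
  by rewrite /a; field; rewrite !gt_eqF.
have -> : 2 * h * ((sinh (theta * y) * cosh (theta * h) + cosh (theta * y) * sinh (theta * h)) /
     (2 * sinh (theta * h) * cosh (theta * h))) =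
   h * (cosh (theta * y) / cosh (theta * h)) + h * sinh (theta * y) / sinh (theta * h).
  by field; rewrite !gt_eqF.
(* The constant part l is merely discounted. *)
have : cosh (theta * y) / cosh (theta * h) <= 1.
  rewrite ler_pdivrMr// mul1r ler_cosh// normrM [leRHS]normrM ler_wpM2l//.
  by rewrite (ger0_norm (ltW h0)).
move=> /(ler_wpM2l l0); rewrite mulr1 mulrDl; lra.
Qed.

End hyperbolic_bound.

Section payoff_expectation.
Context {R : realType} {d : measure_display} {Omega : measurableType d}.
Variables (P : probability Omega R) (beta : R) (beta0 : 0 < beta).
Local Notation freq := (frequency beta).

(** This is [J] for the reflected motion, with [W] as an explicit argument so that it can be
    exchanged for a tame motion. *)
Definition payoff_mean (W : R -> Omega -> R) (x : R) (A : set R) : \bar R :=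
  (\int[P]_w payoff beta W x A w)%E.

Section tame.
Variable W : R -> Omega -> R.
Hypotheses (hW : brownian_motion P W) (tW : forall w, tame_path (W ^~ w)).

Lemma payoff_mean_le (x c : R) (A : set R) : 0 <= c ->
  (forall w, payoff beta W x A w <= c%:E)%E -> (payoff_mean W x A <= c%:E)%E.
Proof.
move=> c0 H; apply: (@le_trans _ _ (\int[P]_w c%:E)%E).
  apply: (@ge0_le_integral_outside _ _ _ P set0) => //.
  - by move=> w; exact: payoff_ge0.
by rewrite integral_cst//= probability_setT mule1.
Qed.

(* The exit position is recovered as the logarithm of a measurable function. *)
Let mZ (y h : R) : `|y| <= h ->
  measurable_fun setT (fun w => y + W (exit_time (W ^~ w) y h) w).
Proof.
move=> yh.
have mF := (exit_exp_martingale hW tW 1 yh).1.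
have mD := measurable_exit_discount hW tW y h (- 2^-1).
have : measurable_fun setT (fun w => ln (
    expR (1 * (y + W (exit_time (W ^~ w) y h) w) - 1 ^+ 2 * exit_time (W ^~ w) y h / 2) *
    expR (- (- 2^-1 * exit_time (W ^~ w) y h)))).
  apply: measurableT_comp => //; exact: measurable_funM.
congr (measurable_fun _ _); apply/funext => w.
by rewrite -expRD expRK; field.
Qed.

(** Outside the null set of [exit_regular] the payoff is the discounted exit position. [Phi] is that
    position in a form known to be measurable. *)
Lemma payoff_mean_exit (x l r : R) (A : set R) (Phi : Omega -> R) : l < x -> x < r ->
  (forall y, l < y -> y < r -> ~ A `|y|) ->
  (forall e, 0 < e -> exists2 y, A `|y| & l - e < y <= l) ->
  (forall e, 0 < e -> exists2 y, A `|y| & r <= y < r + e) ->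
  let s w := exit_time (W ^~ w) (x - (l + r) / 2) ((r - l) / 2) in
  measurable_fun setT Phi -> (forall w, Phi w = `|x + W (s w) w|) ->
  payoff_mean W x A =
  (\int[expo]_u \int[P]_w (expR (- (freq u ^+ 2 / 2 * s w)) * Phi w)%:E)%E.
Proof.
move=> lx xr gap accl accr s mPhi PhiE.
have yh : `|x - (l + r) / 2| < (r - l) / 2.
  by rewrite ltr_norml; apply/andP; split; lra.
have [N [mN N0 HN]] := exit_regular hW tW yh.
rewrite /payoff_mean -(discount_mixture P beta0)//.
- apply: (ge0_eq_integral_outside mN N0).
  + by move=> w; exact: payoff_ge0.
  + by move=> w; rewrite lee_fin PhiE mulr_ge0// ltW// discount_gt0// exit_time_ge0.
  move=> w Nw; rewrite PhiE.
  apply: (payoff_gap beta0 (tW) lx xr gap accl accr) => t t0 ts.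
  by have := contra_notP (fun h => HN w h) Nw; apply.
- apply: measurable_exit_time; [exact: bm_measurable hW|exact: tW].
- by move=> w; exact: exit_time_ge0.
- by move=> w; rewrite PhiE.
Qed.

(** For x + W the target leaves the symmetric gap (-r, r), and the exit position has modulus [r] at
    either end. *)
Lemma payoff_mean_interval0 (x r : R) (A : set R) : 0 <= x -> x < r ->
  (forall y, 0 <= y -> y < r -> ~ A y) ->
  (forall e, 0 < e -> exists2 y, A y & r <= y < r + e) ->
  payoff_mean W x A = (exit_value beta x r)%:E.
Proof.
move=> x0 xr gap acc; have r0 : 0 < r := le_lt_trans x0 xr.
have nrx : - r < x by lra.
have yE : x - (- r + r) / 2 = x by field.
have hE : (r - - r) / 2 = r by field.
have xh : `|x| <= r by rewrite ger0_norm// ltW.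
rewrite (@payoff_mean_exit x (- r) r A (cst r))//.
- rewrite yE hE /exit_value.
  transitivity (\int[expo]_u (r%:E * (cosh (freq u * x) / cosh (freq u * r))%:E))%E.
    apply: eq_integral => u _; rewrite -EFinM -(exit_laplace hW tW xh) [r * _]mulrC.
    have iD : P.-integrable setT (EFin \o (fun w =>
        expR (- (freq u ^+ 2 / 2 * exit_time (W ^~ w) x r)))).
      apply: (@integrable_bounded _ _ _ P _ 1).
        exact: (measurable_exit_discount hW tW).
      move=> w; rewrite ger0_norm ?expR_ge0// -[leRHS]expR0 ler_expR oppr_le0.
      by rewrite mulr_ge0 ?exit_time_ge0// divr_ge0// sqr_ge0.
    rewrite -RintegralZr// /Rintegral fineK//.
    by apply: integrable_fin_num => //; exact: (integrableZr measurableT _ iD).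
  have iR := integrable_cosh_ratio beta0 x0 (ltW xr).
  by rewrite integralZl// /Rintegral EFinM fineK// integrable_fin_num.
- move=> y y1 y2; apply: gap => //.
  by rewrite ltr_norml y1.
- move=> e e0; have [y Ay /andP[y1 y2]] := acc e e0.
  exists (- y); first by rewrite normrN ger0_norm// (le_trans (ltW r0)).
  by apply/andP; split; lra.
- move=> e e0; have [y Ay /andP[y1 y2]] := acc e e0.
  exists y; last by rewrite y1.
  by rewrite ger0_norm// (le_trans (ltW r0)).
- move=> w /=; rewrite yE hE.
  by have -> : `|x + W (exit_time (W ^~ w) x r) w| = r := exit_position (tW w) xh.
Qed.

Lemma payoff_mean_interval (x l r : R) (A : set R) : 0 <= l -> l < x -> x < r ->
  A `<=` [set a | 0 <= a] ->
  (forall y, l < y -> y < r -> ~ A y) ->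
  (forall e, 0 < e -> exists2 y, A y & l - e < y <= l) ->
  (forall e, 0 < e -> exists2 y, A y & r <= y < r + e) ->
  (payoff_mean W x A < x%:E)%E.
Proof.
move=> l0 lx xr A0 gap accl accr.
set m := (l + r) / 2; set h := (r - l) / 2; set y := x - m.
have h0 : 0 < h by rewrite /h; lra.
have mh : h <= m by rewrite /m /h; lra.
have yh : `|y| <= h by rewrite ler_norml /y /m /h; apply/andP; split; lra.
pose s w := exit_time (W ^~ w) y h.
pose Z w := y + W (s w) w.
have Zh w : `|Z w| = h := exit_position (tW w) yh.
have Zge w : - h <= Z w by have := Zh w => E; have := ler_norm (- Z w); rewrite normrN E; lra.
have Zle w : Z w <= h by rewrite -(Zh w) ler_norm.
have mZ1 := mZ yh.
have xW w : x + W (s w) w = m + Z w by rewrite /Z /y; ring.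
rewrite (@payoff_mean_exit x l r A (fun w => m + Z w))//.
- have iDZ u : P.-integrable setT (EFin \o (fun w =>
      expR (- (freq u ^+ 2 / 2 * s w)) * Z w)).
    apply: (@integrable_bounded _ _ _ P _ h).
      by apply: measurable_funM => //; exact: (measurable_exit_discount hW tW).
    move=> w; rewrite normrM Zh ler_piMl ?(ltW h0)// ger0_norm ?expR_ge0//.
    rewrite -[leRHS]expR0 ler_expR oppr_le0.
    by rewrite mulr_ge0 ?exit_time_ge0// divr_ge0// sqr_ge0.
  have iD u : P.-integrable setT (EFin \o (fun w => expR (- (freq u ^+ 2 / 2 * s w)))).
    apply: (@integrable_bounded _ _ _ P _ 1).
      exact: (measurable_exit_discount hW tW).
    move=> w; rewrite ger0_norm ?expR_ge0// -[leRHS]expR0 ler_expR oppr_le0.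
    by rewrite mulr_ge0 ?exit_time_ge0// divr_ge0// sqr_ge0.
  have inner u : 0 < u ->
      (\int[P]_w (expR (- (freq u ^+ 2 / 2 * s w)) * (m + Z w))%:E =
      (m * (cosh (freq u * y) / cosh (freq u * h)) +
        h * sinh (freq u * y) / sinh (freq u * h))%:E)%E.
    move=> u0; rewrite -(exit_laplace hW tW yh).
    rewrite -(exit_laplace_position hW tW yh (freq_gt0 beta0 u0) h0).
    rewrite -RintegralZl// -RintegralD//; last exact: (integrableZl measurableT _ (iD u)).
    rewrite /Rintegral fineK; last first.
      apply: integrable_fin_num => //.
      exact: (integrableD measurableT (integrableZl measurableT m (iD u)) (iDZ u)).
    by apply: eq_integral => w _; congr (_%:E); rewrite /Z /s; ring.
  (* The bound of [interval_value_le], strictly below [x] for u > 0 because x - l < r - l. *)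
  pose v u := l + (x - l) * (cosh (freq u * ((x - l) / 2)) / cosh (freq u * ((r - l) / 2))).
  have x20 : 0 <= (x - l) / 2 by lra.
  have xr2 : (x - l) / 2 <= (r - l) / 2 by lra.
  have iv : expo.-integrable setT (EFin \o v).
    have i1 := finite_measure_integrable_cst expo (l : R) measurableT.
    have i2 := integrableZl measurableT (x - l) (integrable_cosh_ratio beta0 x20 xr2).
    exact: (integrableD measurableT i1 i2).
  apply: (@le_lt_trans _ _ (\int[expo]_u (v u)%:E)%E).
    apply: ge0_le_integral_expo.
    - move=> u; apply: integral_ge0 => w _; rewrite lee_fin mulr_ge0 ?expR_ge0//.
      by have := Zge w; lra.
    - move=> u; rewrite lee_fin /v addr_ge0// mulr_ge0 ?subr_ge0 ?(ltW lx)//.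
      by rewrite divr_ge0// ltW// cosh_gt0.
    - by move=> u u0; rewrite inner// lee_fin; exact: interval_value_le (freq_gt0 beta0 u0) _ _ _.
  rewrite -(fineK (x := (\int[expo]_u (v u)%:E)%E)); last exact: integrable_fin_num.
  rewrite lte_fin -[x in ltRHS]Rintegral_expo_cst.
  apply: lt_Rintegral_expo => //.
    exact: (finite_measure_integrable_cst expo (x : R) measurableT).
  move=> u u0; have f0 := freq_gt0 beta0 u0.
  rewrite /v -ltrBrDl -[ltRHS]mulr1 ltr_pM2l ?subr_gt0//.
  rewrite ltr_pdivrMr ?cosh_gt0// mul1r.
  have ab : freq u * ((x - l) / 2) < freq u * ((r - l) / 2) by rewrite ltr_pM2l//; lra.
  have a0 : 0 <= freq u * ((x - l) / 2) by rewrite mulr_ge0// ltW.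
  have ba : freq u * ((r - l) / 2) != freq u * ((x - l) / 2) by rewrite gt_eqF.
  apply: le_lt_trans (cosh_tangent_lt ba).
  by rewrite lerDl mulr_ge0 ?sinh_ge0// subr_ge0 ltW.
- by move=> z lz zr; rewrite ger0_norm; [exact: gap|rewrite ltW// (le_lt_trans l0)].
- move=> e e0; have [z Az lz] := accl e e0; exists z => //.
  by rewrite ger0_norm//; exact: A0.
- move=> e e0; have [z Az rz] := accr e e0; exists z => //.
  by rewrite ger0_norm//; exact: A0.
- exact: measurable_funD.
- move=> w; rewrite -/m -/h -/y -/(s w) xW ger0_norm//.
  by have := Zge w; lra.
Qed.

End tame.

(** The payoff depends only on nonnegative times, where the two motions agree outside a null set. *)
Lemma payoff_mean_tame (W : R -> Omega -> R) : brownian_motion P W ->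
  exists W', [/\ brownian_motion P W', forall w, tame_path (W' ^~ w) &
    payoff_mean W = payoff_mean W'].
Proof.
move=> hW; have [W' [hW' tW' [N [mN N0 HN]]]] := brownian_tame_modification hW.
exists W'; split => //; apply/funext => x; apply/funext => A.
apply: (ge0_eq_integral_outside mN N0) => [w|w|w Nw]; [exact: payoff_ge0..|].
apply/esym/eq_payoff => t t0; apply: contrapT => H; apply: Nw; apply: HN => /= K.
by apply: H; exact: K.
Qed.

End payoff_expectation.

(** * Equilibria *)

Section equilibria.
Context {R : realType} {d : measure_display} {Omega : measurableType d}.
Variables (P : probability Omega R) (beta : R) (beta0 : 0 < beta).
Variable W : R -> Omega -> R.
Hypothesis hW : brownian_motion P W.

Let E : set R := `[0, +oo[%classic.
Let id_payoff : R -> R := fun x => x.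
Local Notation J := (payoff_mean P beta W).
Local Notation equilibrium :=
  (equilibrium P E (reflected W) id_payoff (discount beta)).
Local Notation optimal_equilibrium :=
  (optimal_equilibrium P E (reflected W) id_payoff (discount beta)).
Local Notation value := (value P (reflected W) id_payoff (discount beta)).

Let valueE x A : value x A = maxe x%:E (J x A). Proof. by []. Qed.

Lemma payoff_mean_below (x l : R) (A : set R) : 0 <= l -> A `<=` [set a | a <= l] ->
  (J x A <= l%:E)%E.
Proof.
move=> l0 Al; have [W' [hW' tW' ->]] := payoff_mean_tame beta0 hW.
by apply: payoff_mean_le => // w; exact: payoff_le_below.
Qed.

Lemma payoff_mean_dense (x r : R) (A : set R) : 0 <= r -> r <= x ->
  (forall u v, r <= u -> u < v -> exists2 a, A a & u < a < v) ->
  (J x A <= x%:E)%E.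
Proof.
move=> r0 rx Ad; have [W' [hW' tW' ->]] := payoff_mean_tame beta0 hW.
apply: payoff_mean_le => // [|w]; first exact: le_trans rx.
exact: payoff_le_dense Ad.
Qed.

Lemma payoff_mean_initial (x r : R) (A : set R) : 0 <= x -> x < r ->
  (forall y, 0 <= y -> y < r -> ~ A y) ->
  (forall e, 0 < e -> exists2 y, A y & r <= y < r + e) ->
  J x A = (exit_value beta x r)%:E.
Proof.
move=> x0 xr gap acc; have [W' [hW' tW' ->]] := payoff_mean_tame beta0 hW.
exact: payoff_mean_interval0.
Qed.

Lemma equilibrium_continuation x A : equilibrium A -> 0 <= x -> ~ A x ->
  (x%:E <= J x A)%E.
Proof.
move=> [_ _ TA] x0 Ax; rewrite leNgt; apply/negP => Jx; apply: Ax.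
by rewrite -TA; left; split => //; rewrite /E /= in_itv/= x0.
Qed.

(** An equilibrium is not assumed closed, and density is what paths can detect. *)
Definition dense_half_line (r : R) (A : set R) :=
  [/\ 0 <= r, A `<=` [set a | r <= a] &
      forall u v, r <= u -> u < v -> exists2 a, A a & u < a < v].

(* Otherwise A has a gap above one of its points, and stopping at once inside
   that gap would beat waiting for A. *)
Lemma equilibrium_dense A : equilibrium A -> exists r, dense_half_line r A.
Proof.
move=> eA; have [AE _ _] := eA.
have A0 : A `<=` [set a | 0 <= a] by move=> a /AE; rewrite /E /= in_itv/= andbT.
have wait x : 0 <= x -> ~ A x -> (x%:E <= J x A)%E by exact: equilibrium_continuation.
(* With an empty target, waiting at 1 would pay 0. *)
have AN : A !=set0.
  apply/set0P; apply/eqP => A_0.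
  have := wait 1 ler01; rewrite A_0 => /(_ id) H1.
  have H0 : (J 1 set0 <= 0%:E)%E by apply: payoff_mean_below.
  by have := le_trans H1 H0; rewrite lee_fin ler10.
have Alb : has_lbound A by exists 0 => a /A0.
pose r := inf A.
have r0 : 0 <= r by apply: lb_le_inf => // a /A0.
exists r; split => //; first by move=> a Aa; exact: ge_inf.
move=> u v ru uv; apply: contrapT => /forall2NP noA.
have {}noA a : A a -> u < a -> a < v -> False.
  by move=> Aa ua av; case: (noA a) => //; rewrite ua av.
(* From this point of the hole, [l] and [q] below are the ends of the maximal gap. *)
pose x := (u + v) / 2.
have ux : u < x by rewrite /x; lra.
have xv : x < v by rewrite /x; lra.
have x0 : 0 <= x by rewrite (le_trans r0)// (le_trans ru)// ltW.
have nAx : ~ A x by move=> Ax; exact: noA Ax ux xv.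
have [a0 Aa0 a0v] : exists2 a, A a & a < v.
  have vr : 0 < v - r by rewrite subr_gt0 (le_lt_trans ru).
  have [a Aa] := inf_adherent vr (conj AN Alb).
  by rewrite -/r addrC subrK; exists a.
have low a : A a -> a <= x -> a <= u.
  by move=> Aa ax; rewrite leNgt; apply/negP => ua; apply: (noA a Aa ua); exact: le_lt_trans xv.
have a0u : a0 <= u by rewrite leNgt; apply/negP => ua; exact: (noA a0).
pose L := [set a | A a /\ a <= x].
have LN : L !=set0 by exists a0; split => //; rewrite (le_trans a0u)// ltW.
have Lub : has_ubound L by exists u => a [Aa ax]; exact: low.
pose l := sup L.
have lu : l <= u by apply: ge_sup => // a [Aa ax]; exact: low.
have l0 : 0 <= l.
  by apply: (le_trans (A0 _ Aa0)); apply: (ub_le_sup Lub); split => //; rewrite (le_trans a0u)// ltW.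
have lx : l < x := le_lt_trans lu ux.
have accl e : 0 < e -> exists2 y, A y & l - e < y <= l.
  move=> e0; have [a [Aa ax] ae] := sup_adherent e0 (conj LN Lub).
  by exists a => //; rewrite ae/=; apply: (ub_le_sup Lub).
pose U := [set a | A a /\ x <= a].
(* If no point of [A] lies above [x], waiting pays at most l < x, which is excluded as well. *)
have [UN|UN] := pselect (U !=set0); last first.
  have : (J x A <= l%:E)%E.
    apply: payoff_mean_below => // a Aa /=; apply: (ub_le_sup Lub); split => //.
    rewrite leNgt; apply/negP => xa; apply: UN; exists a; split => //.
    exact: ltW.
  by move=> /(le_trans (wait x x0 nAx)); rewrite lee_fin leNgt lx.
have Ulb : has_lbound U by exists x => a [].
pose q := inf U.
have xq : x < q.
  apply: (lt_le_trans xv); apply: lb_le_inf => // a [Aa xa].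
  by rewrite leNgt; apply/negP => av; apply: (noA a Aa _ av); exact: lt_le_trans xa.
have accr e : 0 < e -> exists2 y, A y & q <= y < q + e.
  move=> e0; have [a [Aa ax] ae] := inf_adherent e0 (conj UN Ulb).
  by exists a => //; rewrite ae andbT; apply: ge_inf.
have gap y : l < y -> y < q -> ~ A y.
  move=> ly yq Ay; have [yx|xy] := lerP y x.
    by move: ly; rewrite ltNge; apply/negP; rewrite negbK; apply: (ub_le_sup Lub).
  move: yq; rewrite ltNge; apply/negP; rewrite negbK.
  by apply: ge_inf => //; split => //; exact: ltW.
have : (J x A < x%:E)%E.
  have [W' [hW' tW' ->]] := payoff_mean_tame beta0 hW.
  exact: (payoff_mean_interval beta0 hW' tW' l0 lx xq A0 gap accl accr).
by apply/negP; rewrite -leNgt; exact: wait.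
Qed.

Lemma payoff_mean_initial_dense (x r : R) A : dense_half_line r A -> 0 <= x ->
  x < r -> J x A = (exit_value beta x r)%:E.
Proof.
move=> [r0 Ar Ad] x0 xr; apply: payoff_mean_initial => //.
  by move=> y _ yr /Ar /=; rewrite leNgt yr.
move=> e e0; have re : r < r + e by rewrite ltrDl.
by have [a Aa /andP[ra ae]] := Ad r (r + e) (lexx _) re; exists a => //; rewrite ltW.
Qed.

Lemma equilibrium_threshold_le a r A : threshold beta a -> equilibrium A ->
  dense_half_line r A -> r <= a.
Proof.
move=> /(thresholdP beta0)[a0 Ga] eA dA; have [r0 Ar _] := dA.
move: r0; rewrite le_eqVlt => /predU1P[<-|r0]; first exact: ltW.
rewrite leNgt; apply/negP => ar.
have := threshold_fun_lt beta0 a0 ar; rewrite Ga ltNge => /negP; apply.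
apply: threshold_fun_le1 => // x x0 xr.
rewrite -lee_fin -(payoff_mean_initial_dense dA)//.
by apply: equilibrium_continuation => // /Ar /=; rewrite leNgt xr.
Qed.

Lemma half_line_dense (a : R) : 0 <= a -> dense_half_line a `[a, +oo[%classic.
Proof.
move=> a0; split => // [x|u v au uv]; first by rewrite /= in_itv/= andbT.
exists ((u + v) / 2); last by apply/andP; split; lra.
by rewrite /= in_itv/= andbT; lra.
Qed.

Lemma half_line_equilibrium a : threshold beta a -> equilibrium `[a, +oo[%classic.
Proof.
move=> /(thresholdP beta0)[a0 Ga]; have da := half_line_dense (ltW a0).
split => //.
  move=> x; rewrite /E /= !in_itv/= !andbT; exact: le_trans (ltW a0).
apply/seteqP; split => x.
  move=> [[xE Jx]|[_ //]]; move: xE; rewrite /E /= !in_itv/= !andbT => x0.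
  rewrite leNgt; apply/negP => xa; move: Jx.
  rewrite -[Defs.J _ _ _ _ _ _]/(J x _) (payoff_mean_initial_dense da)// lte_fin.
  by apply/negP; rewrite -leNgt ltW// exit_value_gt.
move=> xA; have ax : a <= x by move: xA; rewrite /= in_itv/= andbT.
have xE : E x by rewrite /E /= in_itv/= (le_trans (ltW a0) ax).
have [_ _ dd] := da.
have Jx : (J x `[a, +oo[%classic <= x%:E)%E := payoff_mean_dense (ltW a0) ax dd.
(* Strict preference puts [x] in the stopping set; under indifference its membership in the
   half-line decides. *)
move: Jx; rewrite le_eqVlt => /predU1P[Jx|Jx]; last by left; split.
by right; split.
Qed.

Lemma closed_half_line (a : R) : 0 <= a -> closed_in_state_space E `[a, +oo[%classic.
Proof.
move=> a0; split; first by move=> x; rewrite /E /= !in_itv/= !andbT; exact: le_trans.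
apply/closed_subspaceP; exists `[a, +oo[%classic => //.
rewrite (_ : `[a, +oo[%classic = [set x : R | a <= x]); first exact: closed_ge.
by apply/seteqP; split => x; rewrite /= in_itv/= andbT.
Qed.

Lemma closed_dense_half_line r A : closed_in_state_space E A ->
  dense_half_line r A -> A = `[r, +oo[%classic.
Proof.
move=> [AE /closed_subspaceP[V cV VA]] [r0 Ar Ad].
apply/seteqP; split => x; first by move=> /Ar; rewrite /= in_itv/= andbT.
rewrite /= in_itv/= andbT => rx.
have xE : E x by rewrite /E /= in_itv/= (le_trans r0 rx).
suff : (A `&` E) x by case.
rewrite -VA; split => //; apply: cV => B /nbhs_ballP[e /= e0 He].
have xe : x < x + e by rewrite ltrDl.
have [a Aa /andP[xa ae]] := Ad x (x + e) rx xe.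
exists a; split.
  have : (A `&` E) a by split => //; exact: AE.
  by rewrite -VA => -[].
by apply: He; rewrite /ball/= distrC gtr0_norm ?subr_gt0// ltrBlDl.
Qed.

Lemma half_line_optimal a : threshold beta a -> optimal_equilibrium `[a, +oo[%classic.
Proof.
move=> ta; have [a0 Ga] := (thresholdP beta0 a).1 ta.
split; first exact: half_line_equilibrium.
move=> x B; rewrite /E /= in_itv/= andbT => x0 eB; rewrite !valueE.
have [r dB] := equilibrium_dense eB; have [r0 _ Bd] := dB.
rewrite ge_max le_max lexx /=.
(* From x >= r, waiting for [B] pays at most [x], so the value of [B] is [x] itself. *)
have [rx|xr] := lerP r x; first by rewrite le_max (payoff_mean_dense r0 rx Bd).
have ra := equilibrium_threshold_le ta eB dB.
rewrite le_max; apply/orP; right.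
rewrite (payoff_mean_initial_dense dB)//.
rewrite (payoff_mean_initial_dense (half_line_dense (ltW a0)))//; last exact: lt_le_trans ra.
by rewrite lee_fin exit_value_mono// ?(ltW xr)// (le_lt_trans x0).
Qed.

(** A closed equilibrium is [r, +oo[ with r <= a. If r < a, its value at the point r is r, while [a,
    +oo[ gives v(r, a) > r there. *)
Lemma closed_optimal_unique a A : threshold beta a -> closed_in_state_space E A ->
  optimal_equilibrium A -> A = `[a, +oo[%classic.
Proof.
move=> ta cA [eA oA]; have [a0 Ga] := (thresholdP beta0 a).1 ta.
have [r dA] := equilibrium_dense eA; have [r0 _ Ad] := dA.
rewrite (closed_dense_half_line cA dA); suff -> : r = a by [].
apply/eqP; rewrite eq_le (equilibrium_threshold_le ta eA dA) /=.
rewrite leNgt; apply/negP => ra.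
have rE : E r by rewrite /E /= in_itv/= r0.
have := oA r _ rE (half_line_equilibrium ta); rewrite !valueE.
rewrite (payoff_mean_initial_dense (half_line_dense (ltW a0)))//.
have Jr : (J r A <= r%:E)%E by exact: payoff_mean_dense Ad.
rewrite (max_l Jr) ge_max lexx /= lee_fin; apply/negP; rewrite -ltNge.
exact: exit_value_gt.
Qed.

End equilibria.

Theorem proposition6p1 (R : realType) (d : measure_display)
    (Omega : measurableType d) (P : probability Omega R) (W : R -> Omega -> R)
    (hW : brownian_motion P W) (beta : R) (hbeta : 0 < beta) :
  let E : set R := `[0, +oo[%classic in
  let X : R -> R -> Omega -> R := fun x t w => `|x + W t w| in
  let f : R -> R := fun x => x in
  let delta : R -> R := fun t => 1 / (1 + beta * t) in
  (exists! a : R, threshold beta a) /\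
  forall a : R, threshold beta a ->
    let Rstar : set R :=
      \bigcap_(A in [set A | equilibrium P E X f delta A /\
                             closed_in_state_space E A]) A in
    [/\ Rstar = `[a, +oo[%classic,
        closed_in_state_space E Rstar /\
          optimal_equilibrium P E X f delta Rstar &
        forall A : set R, closed_in_state_space E A ->
          optimal_equilibrium P E X f delta A -> A = Rstar].
Proof.
move=> E X f delta; split; first exact: threshold_exists_unique.
move=> a ta Rstar; have [a0 _] := (thresholdP hbeta a).1 ta.
(* The half-line from [a] belongs to the family, and every member is a half-line starting at or
   below [a]. *)
have RE : Rstar = `[a, +oo[%classic.
  apply/seteqP; split => x.
    apply; split; first exact: half_line_equilibrium.
    exact: closed_half_line (ltW a0).
  move=> ax A [eA cA]; have [r dA] := equilibrium_dense hbeta hW eA.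
  rewrite (closed_dense_half_line cA dA) /= in_itv/= andbT.
  have ra := equilibrium_threshold_le hbeta hW ta eA dA.
  by apply: le_trans ra _; move: ax; rewrite /= in_itv/= andbT.
rewrite RE; split => //.
  split; first exact: closed_half_line (ltW a0).
  exact: half_line_optimal.
move=> A cA oA; exact: (closed_optimal_unique hbeta hW ta cA oA).
Qed.
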